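(* Let $\mu>\pi/2$, let $c_0>-1$, and let $\nu=\pi/(2\mu)$. For $\ell,j\in\mathbb{Z}$, $\ell\ge 0$, let $$H_{\ell,j}(z_1,z_2)=E_{c_0+\nu\ell+i(j+1)/2}(z_1,z_2)\,z_2^j .$$ Then, for each integer $m\ge 0$ and each $j\in\mathbb{Z}$, $$\|H_{2m+1,j}\|^2_{A^2(\mathcal{W}'_\mu)}>\sum_{j'=-\infty}^{+\infty}\sum_{k=0}^{+\infty}\frac{1}{\|H_{2k,j'}\|^2_{A^2(\mathcal{W}'_\mu)}}\big|\big\langle H_{2m+1,j},\,H_{2k,j'}\big\rangle\big|^2,$$ and, analogously, for each integer $k\ge 0$ and each $j\in\mathbb{Z}$, $$\|H_{2k,j}\|^2_{A^2(\mathcal{W}'_\mu)}>\sum_{j'=-\infty}^{+\infty}\sum_{m=0}^{+\infty}\frac{1}{\|H_{2m+1,j'}\|^2_{A^2(\mathcal{W}'_\mu)}}\big|\big\langle H_{2k,j},\,H_{2m+1,j'}\big\rangle\big|^2 .$$ Hence neither the system $\{H_{2k,j}: j\in\mathbb{Z},\ k=0,1,2,\dots\}$ nor the system $\{H_{2m+1,j}: j\in\mathbb{Z},\ m=0,1,2,\dots\}$ is complete in $A^2(\mathcal{W}'_\mu)$.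
   Context: For $\mu>0$, the truncated worm domain is $$\mathcal{W}'_\mu=\big\{(z_1,z_2)\in\mathbb{C}^2:\ z_2\neq 0,\ \big|z_1-e^{i\log|z_2|^2}\big|^2<1,\ \big|\log|z_2|^2\big|<\mu\big\}.$$ $A^2(\mathcal{W}'_\mu)$ is the Bergman space of holomorphic functions on $\mathcal{W}'_\mu$ that are square integrable with respect to Lebesgue measure, with the $L^2$ inner product $\langle\cdot,\cdot\rangle$. For $\eta\in\mathbb{C}$, $E_\eta$ is the holomorphic function on $\mathcal{W}'_\mu$ given by $$E_\eta(z)=e^{\eta L(z)},\qquad L(z)=\log\big(z_1e^{-i\log|z_2|^2}\big)+i\log|z_2|^2,$$ where $\log$ of a complex number denotes the principal branch (on $\mathcal{W}'_\mu$ the number $z_1e^{-i\log|z_2|^2}$ lies in the disk $\{|\zeta-1|<1\}$). A subset of a Hilbert space is complete if its linear span is dense; equivalently, if $0$ is the only vector orthogonal to all its elements. *)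

(* Defs.v *)
From HB Require Import structures.
From mathcomp Require Import all_boot all_order all_algebra.
From mathcomp Require Import all_classical all_reals all_analysis.
From mathcomp Require Import complex.

Set Implicit Arguments.
Unset Strict Implicit.
Unset Printing Implicit Defensive.

Import Order.TTheory GRing.Theory Num.Theory.
Import numFieldNormedType.Exports.

Local Open Scope ring_scope.
Local Open Scope classical_set_scope.
Local Open Scope complex_scope.

Section ComplexFunctions.
Context {R : realType}.
Implicit Types z : R[i].

Definition cabs z : R := complex.Re `|z|.

Definition cexp z : R[i] :=
  (expR (complex.Re z))%:C * (cos (complex.Im z) +i* sin (complex.Im z)).

(* principal argument, in ]-pi, pi] for z != 0 *)
Definition carg z : R :=
  let a := acos (complex.Re z / cabs z) in
  if 0 <= complex.Im z then a else - a.

Definition clog z : R[i] := ln (cabs z) +i* carg z.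

End ComplexFunctions.

(* The alias R[i]^o carries the normed module structure of R[i] over itself,
   so that `differentiable` on C2 R means complex differentiability. *)
Notation C2 R := (R[i]^o * R[i]^o)%type.

Section BergmanSpace.
Context {R : realType}.
Implicit Types (D : set (C2 R)) (f g : C2 R -> R[i]^o) (S : set (C2 R -> R[i]^o)).

(* identification of R^4 with C^2, used to transport Lebesgue measure *)
Definition real_to_C2 (p : (R * R) * (R * R)) : C2 R :=
  (p.1.1 +i* p.1.2, p.2.1 +i* p.2.2).

(* Lebesgue measure on R^2, with the sigma-finite instance that products with
   it as second factor require *)
Definition lebesgue2 : set (measurableTypeR R * measurableTypeR R) -> \bar R :=
  (@lebesgue_measure R \x @lebesgue_measure R)%E.

HB.instance Definition _ := Measure.on lebesgue2.

Fact lebesgue2_sigma_finite : sigma_finite setT lebesgue2.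
Proof.
have /sigma_finiteP[F [TF ndF Foo]] := sigma_finiteT (@lebesgue_measure R).
exists (fun n => F n `*` F n).
  rewrite -setXTT TF predeqE => -[x y]; split.
    move=> [/= [n _ Fnx] [k _ Fky]]; exists (maxn n k) => //; split.
    - by move: x Fnx; exact/subsetPset/ndF/leq_maxl.
    - by move: y Fky; exact/subsetPset/ndF/leq_maxr.
  by move=> [n _ []/= ? ?]; split; exists n.
move=> k; have [mF Fk] := Foo k.
split; first exact: measurableX.
by rewrite /lebesgue2 product_measure1E// lte_mul_pinfty// ge0_fin_numE.
Qed.

HB.instance Definition _ :=
  Measure_isSigmaFinite.Build _ _ _ lebesgue2 lebesgue2_sigma_finite.

Definition lebesgue4 :
    {measure set ((measurableTypeR R * measurableTypeR R) *
                  (measurableTypeR R * measurableTypeR R))%type -> \bar R} :=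
  (lebesgue2 \x lebesgue2)%E.

Definition sqnormL2 D f : \bar R :=
  (\int[lebesgue4]_(p in real_to_C2 @^-1` D)
    (cabs (f (real_to_C2 p)) ^+ 2)%:E)%E.

(* Rintegral is real-valued, so real and imaginary parts are integrated
   separately *)
Definition innerL2 D f g : R[i] :=
  let h p : R[i] := f (real_to_C2 p) * (g (real_to_C2 p))^* in
  (\int[lebesgue4]_(p in real_to_C2 @^-1` D) complex.Re (h p)) +i*
  (\int[lebesgue4]_(p in real_to_C2 @^-1` D) complex.Im (h p)).

Definition holomorphic_on D f := forall z : C2 R, D z -> differentiable f z.

(* Elements of A^2(D) are represented by total functions; only their values
   on the open set D matter. *)
Definition bergman D : set (C2 R -> R[i]^o) :=
  [set f | holomorphic_on D f /\ (sqnormL2 D f < +oo)%E].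

Definition linear_span S : set (C2 R -> R[i]^o) :=
  [set f | exists (n : nat) (c : 'I_n -> R[i]) (g : 'I_n -> C2 R -> R[i]^o),
    (forall i, S (g i)) /\ forall z, f z = \sum_(i < n) c i * g i z].

Definition bergman_complete D S :=
  forall f, bergman D f -> forall e : R, 0 < e ->
    exists2 g, linear_span S g &
      (sqnormL2 D (fun z => (f z - g z)%R) < (e ^+ 2)%:E)%E.

End BergmanSpace.

Section Worm.
Context {R : realType}.
Implicit Types z : C2 R.

Definition log_sq (w : R[i]) : R := ln (cabs w ^+ 2).

Definition worm (mu : R) : set (C2 R) :=
  [set z | [/\ z.2 != 0,
    cabs (z.1 - cexp (0 +i* log_sq z.2)) ^+ 2 < 1 &
    `|log_sq z.2| < mu]].

Definition wormL z : R[i] :=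
  clog (z.1 * cexp (- (0 +i* log_sq z.2))) + (0 +i* log_sq z.2).

Definition wormE (eta : R[i]) z : R[i] := cexp (eta * wormL z).

Definition wormH (c0 nu : R) (l : nat) (j : int) z : R[i]^o :=
  wormE ((c0 + nu * l%:R) +i* ((j + 1)%:~R / 2)) z * z.2 ^ j.

End Worm.

(* Main.v *)
(* Put [s = log |z_2|^2] and [zeta = z_1 e^{-is}].  Then [H l j] is a function of
   [zeta] times a function of [z_2], and [(z_1, z_2) |-> (zeta, z_2)] is a measure
   preserving map of the worm domain onto the product of the disc
   [|zeta - 1| < 1] and the annulus [|s| < mu].  Rotating [z_2] shows that functions with
   different [j] are orthogonal.  For equal [j] the inner product of [H l j] and
   [H l' j] is a disc integral, bounded by the Cauchy-Schwarz inequality, times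
   a multiple of [int_{-mu}^{mu} e^{i nu (l - l') s} ds], which vanishes when
   [l - l'] is even and nonzero.  For [n = l - l'] odd, the squared cosine of the
   angle between the two functions is therefore at most [(2 / (pi n))^2]; these
   numbers sum to 1 over all odd [n], but since [l' >= 0] infinitely many [n] are
   missing, whence the strict inequalities.  For the incompleteness, multiplying
   one function of the other parity by a suitable [e^{-i nu n s}] gives a
   nonholomorphic square integrable function orthogonal to the whole system but
   not to that function.

   Holomorphy of [H l j]: the function [L] is a continuous logarithm of
   [z_1] on the worm domain. *)
Require Import Defs.
From HB Require Import structures.
From mathcomp Require Import all_boot all_order all_algebra.
From mathcomp Require Import all_classical all_reals all_analysis.
From mathcomp Require Import measurable_realfun.
From mathcomp Require Import complex ring lra zify.

Set Implicit Arguments.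
Unset Strict Implicit.
Unset Printing Implicit Defensive.

Import Order.TTheory GRing.Theory Num.Theory.
Import numFieldNormedType.Exports.

Local Open Scope ring_scope.
Local Open Scope classical_set_scope.
Local Open Scope complex_scope.

(** * Modulus and exponential of a complex number *)

Section ComplexModulus.
Context {R : realType}.
Implicit Types z w : R[i].

(** The shift [i (j + 1) / 2] makes the squared modulus of the factor in [z_2] equal to [|z_2|^(-2)]
    for every [j]. Weighted by this, area on the annulus is a multiple of [ds], so the factors in
    [z_2] with a common [j] behave like exponentials [e^{i a s}] on []-mu, mu[]. Frequencies
    differing by [nu n], [n != 0], have cosine [sin (nu n mu) / (nu n mu)], and [nu mu = pi / 2]
    turns this into [2 sin (pi n / 2) / (pi n)]: this explains both the role of parity and the
    constant [2 / (pi n)]. The disc integrals are never evaluated; [c0 > -1] makes [|zeta|^(2 a)]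
    integrable near the boundary point [0] of the disc. Polar coordinates are replaced by the image
    of planar measure under the squared modulus, known up to the factor [disc_area], which cancels
    in every ratio.

    Incompleteness is not deduced from the strict inequalities. Completeness is an approximation
    property, so a square integrable function orthogonal to the system but not to some Bergman
    function refutes it through the Cauchy-Schwarz inequality. *)

Lemma cabsE z : cabs z = Num.sqrt (complex.Re z ^+ 2 + complex.Im z ^+ 2).
Proof. by rewrite /cabs normc_def. Qed.

Lemma norm_cabs z : `|z| = (cabs z)%:C.
Proof. by rewrite cabsE normc_def. Qed.

Lemma cabs_ge0 z : 0 <= cabs z.
Proof. by rewrite cabsE sqrtr_ge0. Qed.

Lemma cabs_sqr z : cabs z ^+ 2 = complex.Re z ^+ 2 + complex.Im z ^+ 2.
Proof. by rewrite cabsE sqr_sqrtr// addr_ge0// sqr_ge0. Qed.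

Lemma cabs_eq0 z : (cabs z == 0) = (z == 0).
Proof. by rewrite -[RHS]normr_eq0 norm_cabs eq_complex /= eqxx andbT. Qed.

Lemma cabs_gt0 z : (0 < cabs z) = (z != 0).
Proof. by rewrite lt_neqAle cabs_ge0 andbT eq_sym cabs_eq0. Qed.

Lemma cabs0 : cabs (0 : R[i]) = 0.
Proof. by apply/eqP; rewrite cabs_eq0. Qed.

Lemma cabsM z w : cabs (z * w) = cabs z * cabs w.
Proof.
by apply: (@complexI R); rewrite rmorphM /= -!norm_cabs normrM.
Qed.

Lemma cabsV z : cabs z^-1 = (cabs z)^-1.
Proof. by apply: (@complexI R); rewrite fmorphV /= -!norm_cabs normfV. Qed.

Lemma cabsD z w : cabs (z + w) <= cabs z + cabs w.
Proof. by rewrite -lecR rmorphD /= -!norm_cabs ler_normD. Qed.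

Lemma cabsN z : cabs (- z) = cabs z.
Proof. by rewrite /cabs normrN. Qed.

Lemma cabs_conj z : cabs z^* = cabs z.
Proof. by rewrite /cabs normcJ. Qed.

Lemma cabs_real (x : R) : cabs x%:C = `|x|.
Proof. by rewrite cabsE /= expr0n addr0 sqrtr_sqr. Qed.

Lemma le_Re_cabs z : `|complex.Re z| <= cabs z.
Proof. by have := normc_ge_Re z; rewrite norm_cabs lecR. Qed.

Lemma le_Im_cabs z : `|complex.Im z| <= cabs z.
Proof.
by rewrite cabsE -sqrtr_sqr ler_wsqrtr// lerDr sqr_ge0.
Qed.

Lemma cabs_le_ReIm z : cabs z <= `|complex.Re z| + `|complex.Im z|.
Proof.
rewrite -(ler_pXn2r (ltn0Sn 1)) ?nnegrE ?cabs_ge0 ?addr_ge0//.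
rewrite cabs_sqr sqrrD !real_normK ?num_real// lerD2r lerDl.
by rewrite mulrn_wge0// mulr_ge0.
Qed.

End ComplexModulus.

Section ComplexExponential.
Context {R : realType}.
Implicit Types z w : R[i].

Lemma cexpE z : cexp z = expR (complex.Re z) * cos (complex.Im z)
  +i* (expR (complex.Re z) * sin (complex.Im z)).
Proof. by rewrite /cexp; case: z => x y /=; simpc. Qed.

Lemma cexpD z w : cexp (z + w) = cexp z * cexp w.
Proof.
rewrite !cexpE; case: z => x y; case: w => u v /=.
rewrite expRD cosD sinD; simpc; congr (_ +i* _); ring.
Qed.

Lemma cexp0 : cexp 0 = 1 :> R[i].
Proof. by rewrite cexpE /= expR0 cos0 sin0 mulr1 mulr0. Qed.

Lemma cabs_cexp z : cabs (cexp z) = expR (complex.Re z).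
Proof.
rewrite cexpE cabsE /= !exprMn -mulrDr cos2Dsin2 mulr1 sqrtr_sqr.
by rewrite ger0_norm ?expR_ge0.
Qed.

Lemma cexp_neq0 z : cexp z != 0.
Proof. by rewrite -cabs_gt0 cabs_cexp expR_gt0. Qed.

Lemma cexpN z : cexp (- z) = (cexp z)^-1.
Proof.
apply: (mulfI (cexp_neq0 z)).
by rewrite -cexpD subrr cexp0 divff ?cexp_neq0.
Qed.

Lemma cexp_conj z : (cexp z)^* = cexp z^*.
Proof. by rewrite !cexpE; case: z => x y /=; rewrite cosN sinN mulrN. Qed.

Lemma norm_sin_le (y : R) : `|sin y| <= `|y|.
Proof.
wlog y0 : y / 0 <= y.
  move=> H; case: (leP 0 y) => [/H//|/ltW y0].
  by rewrite -normrN -sinN -(normrN y) H// oppr_ge0.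
rewrite (ger0_norm y0).
have [c _] : exists2 c, c \in `[0, y]%R & sin y - sin 0 = cos c * (y - 0).
  apply: MVT_segment => //.
  by apply: continuous_subspaceT => x; exact: continuous_sin.
rewrite sin0 !subr0 => ->; rewrite normrM (ger0_norm y0).
by rewrite ler_piMl// cos_max.
Qed.

Lemma norm_cos_sub1_le (y : R) : `|cos y - 1| <= y ^+ 2.
Proof.
have -> : cos y - 1 = - (sin (y / 2) ^+ 2 *+ 2).
  rewrite [in LHS](_ : y = (y / 2) *+ 2); last by rewrite -mulr_natr divfK.
  by rewrite cos_mulr2n cos2sin2; ring.
rewrite normrN ger0_norm ?mulrn_wge0 ?sqr_ge0//.
have : sin (y / 2) ^+ 2 <= (y / 2) ^+ 2.
  by rewrite -[leLHS]real_normK ?num_real// -[leRHS]real_normK ?num_real//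
    ler_pXn2r ?nnegrE// norm_sin_le.
have := sqr_ge0 y; rewrite exprMn; set s := sin _ ^+ 2; set y2 := y ^+ 2; lra.
Qed.

Lemma norm_sin_sub_le (y : R) : `|y| <= 1 -> `|sin y - y| <= y ^+ 2.
Proof.
wlog y0 : y / 0 <= y.
  move=> H; case: (leP 0 y) => [/H//|/ltW y0 y1].
  rewrite -normrN opprD -sinN -(sqrrN y) H ?oppr_ge0//.
  by rewrite normrN.
rewrite (ger0_norm y0) => y1.
have [c] : exists2 c, c \in `[0, y]%R &
    (sin y - y) - (sin 0 - 0) = (cos c - 1) * (y - 0).
  apply: (@MVT_segment _ (fun x => sin x - x) (fun x => cos x - 1)) => //.
  by apply: continuous_subspaceT => x; apply: cvgB;
     [exact: continuous_sin|exact: cvg_id].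
rewrite in_itv /= => /andP[c0 cy].
rewrite sin0 !subr0 => ->; rewrite normrM (ger0_norm y0) expr2 ler_wpM2r//.
apply: le_trans (norm_cos_sub1_le c) _; rewrite expr2.
by apply: le_trans (ler_pM _ _ cy (le_trans cy y1)) _; rewrite ?mulr1.
Qed.

(** The lower bound is [1 + x <= e^x]; the same inequality at [- x] gives [e^x (1 - x) <= 1], hence
    the upper bound. *)
Lemma norm_expR_sub1_le (x : R) : `|x| <= 1 / 2 ->
  `|expR x - 1 - x| <= 2 * x ^+ 2.
Proof.
rewrite ler_norml => /andP[x1 x2].
have h1 := expR_ge1Dx x; have h2 := expR_ge1Dx (- x).
rewrite ger0_norm; last by lra.
have : expR x * (1 - x) <= 1.
  by rewrite -[leRHS](expRxMexpNx_1 x) ler_wpM2l ?expR_ge0.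
set e := expR x => he.
have hp : 0 < 1 - x by lra.
rewrite -(ler_pM2r hp).
have : 0 <= x ^+ 2 by exact: sqr_ge0.
have : 0 <= x ^+ 2 * (1/2 - x) by rewrite mulr_ge0 ?sqr_ge0//; lra.
nra.
Qed.

(** The error splits into four pieces, each at most [2 |z|^2]; the constant 12 leaves room. The
    quadratic order is what yields the derivative of [cexp] and, by inversion, that of a continuous
    logarithm. *)
Lemma cexp_taylor1 z : cabs z <= 1 / 2 ->
  cabs (cexp z - 1 - z) <= 12 * cabs z ^+ 2.
Proof.
move=> z1; have := le_Re_cabs z; have := le_Im_cabs z.
rewrite cexpE; case: z z1 => x y /= z1; simpc => hy hx.
set r := cabs (x +i* y) in z1 hx hy *.
have r0 : 0 <= r by exact: cabs_ge0.
apply: le_trans (cabs_le_ReIm _) _ => /=.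
have hE := norm_expR_sub1_le (le_trans hx z1).
have hC := norm_cos_sub1_le y.
have hS : `|sin y - y| <= y ^+ 2 by apply: norm_sin_sub_le; lra.
have x2 : x ^+ 2 <= r ^+ 2.
  by rewrite -[leLHS]real_normK ?num_real// ler_pXn2r ?nnegrE.
have y2 : y ^+ 2 <= r ^+ 2.
  by rewrite -[leLHS]real_normK ?num_real// ler_pXn2r ?nnegrE.
set e := expR x in hE *.
have rr : r ^+ 2 <= r / 2 by rewrite expr2; nra.
have e2 : `|e - 1| <= 2 * r.
  have -> : e - 1 = (e - 1 - x) + x by ring.
  by apply: le_trans (ler_normD _ _) _; lra.
have e0 : 0 <= e by exact: expR_ge0.
have e3 : e <= 2 by have := ler_norm (e - 1); lra.
have -> : e * cos y - 1 - x = (e - 1 - x) + e * (cos y - 1) by ring.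
have -> : e * sin y - y = e * (sin y - y) + (e - 1) * y by ring.
have A1 : `|e * (cos y - 1)| <= 2 * r ^+ 2.
  by rewrite normrM (ger0_norm e0) ler_pM// (le_trans hC).
have A2 : `|e * (sin y - y)| <= 2 * r ^+ 2.
  by rewrite normrM (ger0_norm e0) ler_pM// (le_trans hS).
have A3 : `|(e - 1) * y| <= 2 * r * r by rewrite normrM ler_pM.
have := ler_normD (e - 1 - x) (e * (cos y - 1)).
have := ler_normD (e * (sin y - y)) ((e - 1) * y).
rewrite expr2 in A1 A2 x2 *; nra.
Qed.

End ComplexExponential.

(** * Limits of complex functions and complex differentiability *)

Section ComplexDifferentiability.
Context {R : realType}.

(** Trades the little-o notation for an explicit estimate with a candidate [df], which [diff_unique]
    identifies with the differential. *)
Lemma diff_criterion (K : numFieldType) (V W : normedModType K) (f : V -> W)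
    (df : {linear V -> W}) (x : V) : continuous df ->
  (forall e : K, 0 < e ->
    \forall h \near (0 : V), `|f (h + x) - f x - df h| <= e * `|h|) ->
  differentiable f x.
Proof.
move=> cdf H.
have Ho : f \o shift x = cst (f x) + df +o_ 0 id.
  apply/eqaddoP => e e0; have := H _ e0; apply: filterS => h /=.
  by rewrite opprD addrA.
by apply/diff_locallyP; rewrite (diff_unique cdf Ho).
Qed.

Lemma norm_cabso (z : R[i]^o) : `|z| = (cabs z)%:C.
Proof. exact: norm_cabs. Qed.

(** The norm of [R[i]^o] takes its values in [R[i]], where a positive element is necessarily real;
    real epsilons therefore suffice. *)
Lemma cvg_cabs {T : Type} (F : set_system T) {FF : Filter F} (f : T -> R[i]^o)
    (l : R[i]^o) :
  (forall e : R, 0 < e -> \forall t \near F, cabs (l - f t) < e) <->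
  f x @[x --> F] --> l.
Proof.
split=> [H|/cvgrPdist_lt H e e0].
  apply/cvgrPdist_lt => e e0.
  have eE : e = (complex.Re e)%:C by rewrite RRe_real// gtr0_real.
  have : 0 < complex.Re e by rewrite -ltcR -eE.
  move=> /H; apply: filterS => t; rewrite -ltcR -eE.
  by rewrite norm_cabso.
have : 0 < e%:C by rewrite ltcR.
move=> /H; apply: filterS => t.
by rewrite norm_cabso ltcR.
Qed.

Lemma cvg_Re {T : Type} (F : set_system T) {FF : Filter F} (f : T -> R[i]^o)
    (l : R[i]^o) : f x @[x --> F] --> l ->
  complex.Re (f x) @[x --> F] --> complex.Re l.
Proof.
move=> /cvg_cabs H; apply/cvgrPdist_lt => e /H; apply: filterS => t.
apply: le_lt_trans; have := le_Re_cabs (l - f t).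
by case: (l) (f t) => a b [c d].
Qed.

Lemma cvg_Im {T : Type} (F : set_system T) {FF : Filter F} (f : T -> R[i]^o)
    (l : R[i]^o) : f x @[x --> F] --> l ->
  complex.Im (f x) @[x --> F] --> complex.Im l.
Proof.
move=> /cvg_cabs H; apply/cvgrPdist_lt => e /H; apply: filterS => t.
apply: le_lt_trans; have := le_Im_cabs (l - f t).
by case: (l) (f t) => a b [c d].
Qed.

Lemma cvg_Complex {T : Type} (F : set_system T) {FF : Filter F} (f g : T -> R)
    (a b : R) : f x @[x --> F] --> a -> g x @[x --> F] --> b ->
  ((f x +i* g x : R[i]^o) @[x --> F] --> (a +i* b : R[i]^o)).
Proof.
move=> /cvgrPdist_lt Hf /cvgrPdist_lt Hg; apply/cvg_cabs => e e0.
have e2 : 0 < e / 2 by rewrite divr_gt0.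
near=> t; apply: le_lt_trans (cabs_le_ReIm _) _.
rewrite /= [ltRHS](splitr e) ltrD//.
  by near: t; exact: Hf.
by near: t; exact: Hg.
Unshelve. all: by end_near. Qed.

Lemma cvg_cabsE {T : Type} (F : set_system T) {FF : Filter F} (f : T -> R[i]^o)
    (l : R[i]^o) : f x @[x --> F] --> l ->
  cabs (f x) @[x --> F] --> cabs l.
Proof.
move=> fl.
under eq_fun do rewrite cabsE !expr2; rewrite cabsE !expr2.
have cr := @cvg_Re _ _ FF _ _ fl; have ci := @cvg_Im _ _ FF _ _ fl.
exact: (cvg_comp _ _ (cvgD (cvgM cr cr) (cvgM ci ci)) (
  @sqrt_continuous R (complex.Re l * complex.Re l + complex.Im l * complex.Im l))).
Qed.

Lemma cvg_cexp {T : Type} (F : set_system T) {FF : Filter F} (f : T -> R[i]^o)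
    (l : R[i]^o) : f x @[x --> F] --> l ->
  (cexp (f x) : R[i]^o) @[x --> F] --> (cexp l : R[i]^o).
Proof.
move=> fl.
under eq_fun do rewrite cexpE; rewrite cexpE.
have ce := cvg_comp _ _ (@cvg_Re _ _ FF _ _ fl) (@continuous_expR R (complex.Re l)).
have cc := cvg_comp _ _ (@cvg_Im _ _ FF _ _ fl) (@continuous_cos R (complex.Im l)).
have cs := cvg_comp _ _ (@cvg_Im _ _ FF _ _ fl) (@continuous_sin R (complex.Im l)).
exact: (cvg_Complex (cvgM ce cc) (cvgM ce cs)).
Qed.

Lemma cexp_differentiable (z : R[i]^o) : differentiable (@cexp R : R[i]^o -> R[i]^o) z.
Proof.
have cl : linear (fun h : R[i]^o => h * cexp z : R[i]^o).
  by move=> a u v; rewrite mulrDl scalerAl.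
pose clM := GRing.isLinear.Build _ _ _ _ _ cl.
pose df : {linear R[i]^o -> R[i]^o} := HB.pack (fun h : R[i]^o => h * cexp z : R[i]^o) clM.
apply: (@diff_criterion _ _ _ _ df).
  by move=> h; exact: (@mulrr_continuous R[i] (cexp z) h).
move=> e e0.
have eE : e = (complex.Re e)%:C by rewrite RRe_real// gtr0_real.
have re0 : 0 < complex.Re e by rewrite -ltcR -eE.
have c0 : 0 < cabs (cexp z) by rewrite cabs_cexp expR_gt0.
(* The first bound is the range of [cexp_taylor1]; the second makes [12 |h| |cexp z|] at most
   [e]. *)
pose d := Num.min (1 / 2) (complex.Re e / (12 * cabs (cexp z))).
have d0 : 0 < d by rewrite lt_min !divr_gt0// mulr_gt0.
have : (0 : R[i]) < d%:C by rewrite ltcR.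
move=> /(nbhs0_lt (V := R[i]^o)); apply: filterS => h.
rewrite [`|_|]norm_cabs ltcR lt_min => /andP[h1 h2].
have -> : cexp (h + z) - cexp z - df h = cexp z * (cexp h - 1 - h).
  by rewrite cexpD /=; ring.
rewrite !norm_cabso.
rewrite eE -rmorphM /= lecR cabsM.
have := cexp_taylor1 (ltW h1).
move: h2; rewrite ltr_pdivlMr ?mulr_gt0//.
set c := cabs (cexp z) in c0 *; set r := cabs h; set q := cabs _; set E := complex.Re e.
move=> h2 h3; apply: le_trans (ler_wpM2l (ltW c0) h3) _.
have : r * (r * (12 * c)) <= r * E by rewrite ler_wpM2l ?cabs_ge0// ltW.
by rewrite expr2 [E * r]mulrC; apply: le_trans; rewrite le_eqVlt; apply/orP; left; apply/eqP; ring.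
Qed.

(* A continuous logarithm [L] of the first coordinate is differentiable: with
   [u = L (x + h) - L x] one has [cexp u - 1 = h.1 / x.1], while
   [cexp u - 1 - u] is quadratic in [u]. *)
Lemma continuous_log_differentiable (L : C2 R -> R[i]^o) (x : C2 R) :
  {for x, continuous L} -> (\forall y \near x, cexp (L y) = y.1) ->
  differentiable L x.
Proof.
move=> cL eL.
have Lx : cexp (L x) = x.1 := nbhs_singleton eL.
have x0 : x.1 != 0 by rewrite -Lx cexp_neq0.
have cl : linear (fun h : C2 R => h.1 / x.1 : R[i]^o).
  by move=> a u v; rewrite mulrDl scalerAl.
pose clM := GRing.isLinear.Build _ _ _ _ _ cl.
pose df : {linear C2 R -> R[i]^o} := HB.pack (fun h : C2 R => h.1 / x.1 : R[i]^o) clM.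
apply: (@diff_criterion _ _ _ _ df).
  move=> h; apply: (@continuous_comp (C2 R) R[i]^o R[i]^o fst ( *%R^~ (x.1)^-1) h).
    exact: cvg_fst.
  exact: mulrr_continuous.
move=> e e0.
have eE : e = (complex.Re e)%:C by rewrite RRe_real// gtr0_real.
have re0 : 0 < complex.Re e by rewrite -ltcR -eE.
have c0 : 0 < cabs x.1 by rewrite cabs_gt0.
(* The first bound gives [12 |u|^2 <= |u| / 2], hence [|u| <= 2 |df h|]; with this, the second
   bounds [12 |u|^2] by [e |h.1|]. *)
pose d := Num.min (1 / 24) (complex.Re e * cabs x.1 / 24).
have d0 : 0 < d by rewrite lt_min !divr_gt0// mulr_gt0.
have shiftx : h + x @[h --> (0 : C2 R)] --> x.
  have : h + x @[h --> (0 : C2 R)] --> 0 + x by apply: cvgD; [exact: cvg_id|exact: cvg_cst].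
  by rewrite add0r.
have /cvg_cabs/(_ _ d0) nL : L (h + x) @[h --> (0 : C2 R)] --> L x.
  exact: (cvg_comp _ _ shiftx cL).
have neL := shiftx _ eL.
near=> h.
have hL : cabs (L x - L (h + x)) < d by near: h.
have heL : cexp (L (h + x)) = h.1 + x.1 by near: h.
set u := L (h + x) - L x.
have ud : cabs u < d by rewrite -cabsN opprB.
move: ud; rewrite lt_min => /andP[u1 u2].
have uk : cexp u - 1 = df h.
  by rewrite cexpD cexpN Lx heL /= mulrDl divff// addrK.
have u3 : cabs u <= 1 / 2 by lra.
have tay := cexp_taylor1 u3; rewrite uk in tay.
have u0 := cabs_ge0 u.
have n1 : `|h.1| <= `|h|.
  rewrite prod_normE [leRHS]/(Num.max _ _).
  by case: ifPn => // /ltW.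
have n2 : cabs (df h) = cabs h.1 / cabs x.1 by rewrite cabsM cabsV.
have tri : cabs u <= cabs (df h) + cabs (df h - u).
  by rewrite -(cabsN (df h - u)) -{1}[u](subKr (df h)); exact: cabsD.
have k1 : cabs (df h - u) <= cabs u / 2 by apply: le_trans tay _; rewrite expr2; nra.
have k2 : cabs u <= 2 * cabs (df h) by lra.
rewrite norm_cabso -cabsN opprB eE; apply: (@le_trans _ _ ((complex.Re e)%:C * (cabs h.1)%:C)); last first.
  by rewrite ler_pM2l -?norm_cabs// ltcR.
rewrite -rmorphM /= lecR; apply: le_trans tay _.
rewrite expr2 mulrA.
have k3 : cabs h.1 = cabs x.1 * cabs (df h).
  by rewrite n2 mulrCA divff ?mulr1// gt_eqF.
rewrite k3.
set c := cabs x.1 in c0 u2 *; set r := cabs u in u0 u2 k2 *; set q := cabs (df h) in k2 *.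
set E := complex.Re e in re0 u2 *.
have q0 : 0 <= q by exact: cabs_ge0.
have : 12 * r * r <= 12 * (E * c / 24) * (2 * q).
  by rewrite ler_pM// ?mulr_ge0// ler_pM2l// ltW.
move=> /le_trans; apply; rewrite le_eqVlt; apply/orP; left; apply/eqP; lra.
Unshelve. all: by end_near. Qed.

End ComplexDifferentiability.

(** * Principal logarithm and holomorphy of the functions H *)

Section ComplexLogarithm.
Context {R : realType}.
Implicit Types z w : R[i].

Lemma ReV_cabs_itv z : -1 <= complex.Re z / cabs z <= 1.
Proof.
have [->|z0] := eqVneq z 0; first by rewrite cabs0 invr0 mulr0 lerN10 ler01.
have c0 : 0 < cabs z by rewrite cabs_gt0.
by rewrite ler_pdivlMr// ler_pdivrMr// mulN1r mul1r -ler_norml le_Re_cabs.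
Qed.

Lemma cos_carg z : cos (carg z) = complex.Re z / cabs z.
Proof.
have h := ReV_cabs_itv z.
by rewrite /carg; case: ifP => _; rewrite ?cosN acosK// in_itv.
Qed.

Lemma sin_carg z : z != 0 -> sin (carg z) = complex.Im z / cabs z.
Proof.
move=> z0; have h := ReV_cabs_itv z.
have c0 : 0 < cabs z by rewrite cabs_gt0.
have e : sin (acos (complex.Re z / cabs z)) = `|complex.Im z| / cabs z.
  rewrite sin_acos//.
  have -> : 1 - (complex.Re z / cabs z) ^+ 2 = (complex.Im z / cabs z) ^+ 2.
    rewrite !exprMn !exprVn; apply: (mulIf (lt0r_neq0 (exprn_gt0 2 c0))).
    rewrite mulrBl !mulfVK ?expf_neq0 ?gt_eqF//.
    by rewrite mul1r cabs_sqr addrAC subrr add0r.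
  by rewrite sqrtr_sqr normrM normfV (ger0_norm (ltW c0)).
rewrite /carg; case: ifPn => [y0|]; first by rewrite e ger0_norm.
by rewrite -ltNge => y0; rewrite sinN e ltr0_norm// mulNr opprK.
Qed.

Lemma clogK z : z != 0 -> cexp (clog z) = z.
Proof.
move=> z0; have c0 : 0 < cabs z by rewrite cabs_gt0.
rewrite cexpE /clog /= lnK ?posrE// cos_carg sin_carg//.
by rewrite ![cabs z * _]mulrC !mulfVK ?gt_eqF//; case: (z).
Qed.

Lemma Re_gt0_neq0 z : 0 < complex.Re z -> z != 0.
Proof. by case: z => x y /= x0; rewrite eq_complex /= negb_and gt_eqF. Qed.

(** On the right half-plane, which contains the disc [|w - 1| < 1], this replaces the sign split of
    [carg] by an expression whose continuity and measurability are visible. There the angle lies in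
    []-pi / 2, pi / 2[], so its tangent determines it. *)
Lemma carg_atan z : 0 < complex.Re z -> carg z = atan (complex.Im z / complex.Re z).
Proof.
move=> x0; have z0 := Re_gt0_neq0 x0.
have c0 : 0 < cabs z by rewrite cabs_gt0.
have cc : 0 < cos (carg z) by rewrite cos_carg divr_gt0.
have h := ReV_cabs_itv z.
have a1 := acos_ge0 h.
have : acos (complex.Re z / cabs z) < pi / 2.
  rewrite ltNge; apply/negP => a2.
  have : cos (acos (complex.Re z / cabs z)) <= cos (pi / 2).
    have := acos_lepi h; rewrite le_eqVlt => /orP[/eqP->|a3].
      by rewrite cospi cos_pihalf lerN10.
    move: a2; rewrite le_eqVlt => /orP[/eqP<-//|a2].
    have p0 := @pi_gt0 R.
    by apply/ltW; rewrite ltr_cos// in_itv /= ?a1 ?(ltW a3)//; apply/andP; split; lra.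
  rewrite acosK ?in_itv//= cos_pihalf leNgt => /negP; apply.
  by rewrite divr_gt0.
move=> a2.
have ca : - (pi / 2) < carg z < pi / 2.
  have p0 := @pi_gt0 R.
  by rewrite /carg; case: ifP => _; apply/andP; split; lra.
rewrite -[LHS]tanK ?in_itv//; congr atan.
rewrite /tan cos_carg sin_carg// invf_div mulrA mulfVK ?gt_eqF//.
Qed.

Lemma carg_bound z : 0 < complex.Re z -> `|carg z| < pi / 2.
Proof.
by move=> x0; rewrite carg_atan// ltr_norml atan_gtNpi2 atan_ltpi2.
Qed.

Lemma cvg_clog {T : Type} (F : set_system T) {FF : Filter F} (f : T -> R[i]^o)
    (l : R[i]^o) : 0 < complex.Re l -> f x @[x --> F] --> l ->
  (clog (f x) : R[i]^o) @[x --> F] --> (clog l : R[i]^o).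
Proof.
move=> l0 fl.
have fr := @cvg_Re _ _ _ FF _ _ fl; have fi := @cvg_Im _ _ _ FF _ _ fl.
have fc := @cvg_cabsE _ _ _ FF _ _ fl.
have c0 : 0 < cabs l by rewrite cabs_gt0 Re_gt0_neq0.
have fln : ln (cabs (f x)) @[x --> F] --> ln (cabs l).
  exact: (cvg_comp _ _ fc (continuous_ln c0)).
have fq : complex.Im (f x) / complex.Re (f x) @[x --> F] -->
    complex.Im l / complex.Re l.
  by apply: cvgM => //; apply: cvgV => //; rewrite gt_eqF.
have fa : atan (complex.Im (f x) / complex.Re (f x)) @[x --> F] --> carg l.
  rewrite carg_atan//.
  exact: (cvg_comp _ _ fq (@continuous_atan R _)).
rewrite /clog; apply: (@cvg_Complex _ _ _ FF _ _ _ _ fln).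
apply: cvg_trans fa; apply: near_eq_cvg.
have : \forall t \near F, 0 < complex.Re (f t).
  by move/cvgrPdist_lt : fr => /(_ _ l0); apply: filterS => t; rewrite ltr_norml => /andP[_]; lra.
by apply: filterS => t t0; rewrite carg_atan.
Qed.

End ComplexLogarithm.

Section WormHolomorphy.
Context {R : realType}.
Implicit Types z : C2 R.

Definition worm_zeta z : R[i] := z.1 * cexp (- (0 +i* log_sq z.2)).

Lemma cabs_cexp_i (s : R) : cabs (cexp (0 +i* s)) = 1.
Proof. by rewrite cabs_cexp /= expR0. Qed.

Lemma opp_imag (s : R) : - (0 +i* s) = 0 +i* (- s).
Proof. by simpc. Qed.

Lemma worm_zetaB1 z :
  cabs (z.1 - cexp (0 +i* log_sq z.2)) = cabs (worm_zeta z - 1).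
Proof.
have -> : worm_zeta z - 1 =
    (z.1 - cexp (0 +i* log_sq z.2)) * cexp (- (0 +i* log_sq z.2)).
  by rewrite mulrBl -cexpD subrr cexp0.
by rewrite cabsM opp_imag cabs_cexp_i mulr1.
Qed.

Lemma Re_gt0_disc (w : R[i]) : cabs (w - 1) ^+ 2 < 1 -> 0 < complex.Re w.
Proof.
case: w => x y; rewrite cabs_sqr /=; rewrite ?subr0.
by have := sqr_ge0 y; have := sqr_ge0 x; set v := y ^+ 2; rewrite sqrrB1; nra.
Qed.

Lemma worm_Re_gt0 mu z : worm mu z -> 0 < complex.Re (worm_zeta z).
Proof. by case=> _ + _; rewrite worm_zetaB1; exact: Re_gt0_disc. Qed.

Lemma cexp_wormL z : z.1 != 0 -> cexp (wormL z) = z.1.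
Proof.
move=> z0; have w0 : z.1 * cexp (- (0 +i* log_sq z.2)) != 0.
  by apply: mulf_neq0 => //; exact: cexp_neq0.
rewrite /wormL cexpD clogK//.
by rewrite -mulrA -cexpD addNr cexp0 mulr1.
Qed.

Lemma cvg_log_sq z : z.2 != 0 -> log_sq y.2 @[y --> z] --> log_sq z.2.
Proof.
move=> z0; have c : cabs y.2 @[y --> z] --> cabs z.2.
  by apply: (@cvg_cabsE _ _ _ _ (snd : C2 R -> R[i]^o)); exact: cvg_snd.
have c2 : cabs y.2 ^+ 2 @[y --> z] --> cabs z.2 ^+ 2.
  by rewrite expr2; under eq_fun do rewrite expr2; exact: (cvgM c c).
by apply: (cvg_comp _ _ c2 (continuous_ln _)); rewrite exprn_gt0// cabs_gt0.
Qed.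

Lemma cvg_wormL z : z.2 != 0 -> 0 < complex.Re (worm_zeta z) ->
  {for z, continuous (@wormL R : C2 R -> R[i]^o)}.
Proof.
move=> z0 zr.
have cs := cvg_log_sq z0.
have c0 : ((0:R)) @[y --> z] --> (0 : R) by exact: cvg_cst.
have cis : ((0 +i* log_sq y.2 : R[i]^o) @[y --> z] --> (0 +i* log_sq z.2 : R[i]^o)).
  exact: cvg_Complex c0 cs.
have cn : ((- (0 +i* log_sq y.2) : R[i]^o) @[y --> z] --> (- (0 +i* log_sq z.2) : R[i]^o)).
  exact: cvgN.
have cz : ((worm_zeta y : R[i]^o) @[y --> z] --> (worm_zeta z : R[i]^o)).
  apply: (@cvgM _ _ _ _ (fst : C2 R -> R[i]^o) (fun y => cexp (- (0 +i* log_sq y.2)))).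
    exact: cvg_fst.
  exact: cvg_cexp.
apply: cvgD; last exact: cis.
exact: cvg_clog.
Qed.

Lemma wormL_differentiable mu z : worm mu z ->
  differentiable (@wormL R : C2 R -> R[i]^o) z.
Proof.
move=> Wz; have zr := worm_Re_gt0 Wz; have [z0 _ _] := Wz.
apply: continuous_log_differentiable; first exact: cvg_wormL.
have z1 : z.1 != 0.
  by apply: contraTneq zr => z1; rewrite /worm_zeta z1 mul0r ltxx.
have c : 0 < cabs z.1 by rewrite cabs_gt0.
have /cvg_cabs/(_ _ c) : (fst : C2 R -> R[i]^o) y @[y --> z] --> z.1 by exact: cvg_fst.
apply: filterS => y; rewrite -cabsN opprB => hy.
apply: cexp_wormL; apply: contraTneq hy => ->.
by rewrite sub0r cabsN ltxx.
Qed.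

Lemma wormE_differentiable mu eta z : worm mu z ->
  differentiable (wormE eta : C2 R -> R[i]^o) z.
Proof.
move=> Wz.
have d1 : differentiable (eta *: (@wormL R : C2 R -> R[i]^o)) z.
  by apply: differentiableZ; exact: wormL_differentiable Wz.
exact: (differentiable_comp d1 (@cexp_differentiable R _)).
Qed.

Lemma exprz_differentiable (j : int) z : z.2 != 0 ->
  differentiable (fun y : C2 R => y.2 ^ j : R[i]^o) z.
Proof.
move=> z0.
have ls : linear (snd : C2 R -> R[i]^o) by [].
pose sM := GRing.isLinear.Build _ _ _ _ _ ls.
pose sL : {linear C2 R -> R[i]^o} := HB.pack (snd : C2 R -> R[i]^o) sM.
have d2 : differentiable (snd : C2 R -> R[i]^o) z.
  apply: (@linear_differentiable _ _ _ sL) => y; exact: cvg_snd.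
have dX n : differentiable (fun y : C2 R => y.2 ^+ n : R[i]^o) z.
  elim: n => [|n IH]; first exact: (@differentiable_cst _ _ _ (1 : R[i]^o) z).
  rewrite (_ : (fun _ => _) = snd * (fun y : C2 R => y.2 ^+ n : R[i]^o)).
    exact: differentiableM.
  by apply/funext => y; rewrite /= exprS.
case: j => n; first exact: dX.
by apply: (differentiableV (dX n.+1)); rewrite expf_neq0.
Qed.

Lemma wormH_holomorphic (mu c0 nu : R) l j :
  holomorphic_on (worm mu) (wormH c0 nu l j).
Proof.
move=> z Wz; have [z0 _ _] := Wz.
exact: (differentiableM (wormE_differentiable _ Wz) (exprz_differentiable j z0)).
Qed.

End WormHolomorphy.

(** * Lebesgue measure on the plane *)

Section Transfer.
Local Open Scope ereal_scope.
Context d1 d2 (X : measurableType d1) (Y : measurableType d2) (R : realType).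
Variables (phi : X -> Y) (mphi : measurable_fun setT phi).
Variables (m : {measure set X -> \bar R}) (n : {measure set Y -> \bar R}).

(** The measures are compared only on subsets of [D]: the image of planar measure under the squared
    modulus is a multiple of Lebesgue measure on the positive half-line but vanishes on the negative
    one. Treating the positive and negative parts of [f] separately avoids any integrability
    assumption. *)
Lemma integral_transfer (D : set Y) (f : Y -> \bar R) : measurable D ->
  (forall A, measurable A -> A `<=` D -> m (phi @^-1` A) = n A) ->
  measurable_fun D f ->
  \int[m]_(x in phi @^-1` D) f (phi x) = \int[n]_(y in D) f y.
Proof.
move=> mD mn mf.
have H (g : Y -> \bar R) : measurable_fun D g -> (forall y, 0 <= g y) ->
    \int[m]_(x in phi @^-1` D) g (phi x) = \int[n]_(y in D) g y.
  move=> mg g0; rewrite -[LHS](ge0_integral_pushforward mphi)//.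
  exact: eq_measure_integral.
rewrite -[LHS]/(\int[m]_(x in phi @^-1` D) (f \o phi) x) [LHS]integralE [RHS]integralE.
congr (_ - _).
  rewrite -(H (f^\+)) //; first by apply: eq_integral => x _; rewrite funepos_comp.
  exact: measurable_funepos.
rewrite -(H (f^\-)) //; first by apply: eq_integral => x _; rewrite funeneg_comp.
exact: measurable_funeneg.
Qed.

End Transfer.

Section LebesgueAffine.
Local Open Scope ereal_scope.
Context {R : realType}.
Notation lam := (@lebesgue_measure R).

Lemma measurable_affine (a b : R) :
  measurable_fun setT (fun x : measurableTypeR R => (a * x + b)%R : measurableTypeR R).
Proof.
by apply: measurable_funD => //; exact: measurable_funM.
Qed.

(** By uniqueness of Lebesgue measure it suffices to compare half-open intervals. For [a < 0] the
    preimage is closed on the other side, which leaves its length unchanged. *)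
Lemma lebesgue_measure_affine (a b : R) (A : set (measurableTypeR R)) :
  a != 0%R -> measurable A ->
  `|a|%:E * lam ((fun x : measurableTypeR R => (a * x + b)%R : measurableTypeR R) @^-1` A) = lam A.
Proof.
move=> a0 mA.
pose p : {measure set (measurableTypeR R) -> \bar R} :=
  measure_function_pushforward__canonical__measure_function_Measure lam (measurable_affine a b).
pose m : {measure set (measurableTypeR R) -> \bar R} := mscale (NngNum (normr_ge0 a)) p.
apply/esym; apply: (@lebesgue_measure_unique R m) => // _ [[u v]] _ <-.
rewrite /m /p /= /mscale /pushforward /=.
have [lta|gta|//] := ltgtP 0%R a; last by move=> e; rewrite e eqxx in a0.
- rewrite [X in _ * lam X](_ : _ = `]((u - b) / a)%R, ((v - b) / a)%R]%classic); last first.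
    apply/seteqP; split => x /=; rewrite !in_itv /=.
      by rewrite ltr_pdivrMr// ler_pdivlMr// ltrBlDr lerBrDr [(x * a)%R]mulrC.
    by rewrite ltr_pdivrMr// ler_pdivlMr// ltrBlDr lerBrDr [(x * a)%R]mulrC.
  rewrite !lebesgue_measure_itv /= !lte_fin ltr_pM2r ?invr_gt0// ltrD2r.
  case: ifP => uv; last by rewrite mule0.
  rewrite gtr0_norm// -!EFinB -EFinM; congr EFin; field; lra.
- rewrite [X in _ * lam X](_ : _ = `[((v - b) / a)%R, ((u - b) / a)%R[%classic); last first.
    apply/seteqP; split => x /=; rewrite !in_itv /=.
      by rewrite ler_ndivrMr// ltr_ndivlMr// ltrBlDr lerBrDr [(x * a)%R]mulrC andbC.
    by rewrite ler_ndivrMr// ltr_ndivlMr// ltrBlDr lerBrDr [(x * a)%R]mulrC andbC.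
  rewrite !lebesgue_measure_itv /= !lte_fin ltr_nM2r ?invr_lt0// ltrD2r.
  case: ifP => uv; last by rewrite mule0.
  rewrite ltr0_norm// -!EFinB -EFinM; congr EFin; field; lra.
Qed.

End LebesgueAffine.

Section LebesguePlane.
Local Open Scope ereal_scope.
Context {R : realType}.
Notation lam := (@lebesgue_measure R).
Notation RR := (measurableTypeR R).
Notation plane := (RR * RR)%type.
Notation lam2 := (@lebesgue2 R).

(** [lebesgue2] integrates the measures of x-sections; uniqueness of the product measure gives
    access to y-sections, on which a shear of the first coordinate is an affine map. *)
Lemma lebesgue2_ysection (A : set plane) : measurable A ->
  lam2 A = \int[lam]_y lam (ysection A y).
Proof.
move=> mA; apply: (@product_measure_unique _ _ _ _ R lam lam (lam \x^ lam)) => //.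
by move=> B C mB mC; exact: product_measure2E.
Qed.

Lemma measurable_shear1 (a b : R) :
  measurable_fun setT (fun p : plane => ((a * p.1 + b * p.2)%R, p.2) : plane).
Proof.
apply: measurable_fun_pair; last exact: measurable_snd.
by apply: measurable_funD; apply: measurable_funM => //.
Qed.

Lemma measurable_shear2 (a b : R) :
  measurable_fun setT (fun p : plane => (p.1, (b * p.1 + a * p.2)%R) : plane).
Proof.
apply: measurable_fun_pair; first exact: measurable_fst.
by apply: measurable_funD; apply: measurable_funM => //.
Qed.

Lemma lebesgue2_shear1 (a b : R) (A : set plane) : a != 0%R -> measurable A ->
  `|a|%:E * lam2 ((fun p : plane => ((a * p.1 + b * p.2)%R, p.2) : plane) @^-1` A)
  = lam2 A.
Proof.
move=> a0 mA.
have mB : measurable ((fun p : plane => ((a * p.1 + b * p.2)%R, p.2) : plane) @^-1` A).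
  by rewrite -[X in measurable X]setTI; exact: measurable_shear1.
rewrite !lebesgue2_ysection// -ge0_integralZl//; last exact: measurable_fun_ysection.
apply: eq_integral => y _.
rewrite -(@lebesgue_measure_affine R a (b * y) (ysection A y) a0); last exact: measurable_ysection.
by congr (_ * lam _); apply/seteqP; split => x; rewrite /ysection /= !inE.
Qed.

Lemma lebesgue2_shear2 (a b : R) (A : set plane) : a != 0%R -> measurable A ->
  `|a|%:E * lam2 ((fun p : plane => (p.1, (b * p.1 + a * p.2)%R) : plane) @^-1` A)
  = lam2 A.
Proof.
move=> a0 mA.
have mB : measurable ((fun p : plane => (p.1, (b * p.1 + a * p.2)%R) : plane) @^-1` A).
  by rewrite -[X in measurable X]setTI; exact: measurable_shear2.
rewrite /lebesgue2 /product_measure1 -ge0_integralZl//; last exact: measurable_fun_xsection.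
apply: eq_integral => x _ /=.
rewrite -(@lebesgue_measure_affine R a (b * x) (xsection A x) a0); last exact: measurable_xsection.
congr (_ * lam _); apply/seteqP; split => y; rewrite /xsection /= !inE /=.
  by rewrite addrC.
by rewrite addrC.
Qed.

Definition plane_mul (c : R[i]) (p : plane) : plane :=
  ((complex.Re c * p.1 - complex.Im c * p.2)%R,
   (complex.Im c * p.1 + complex.Re c * p.2)%R).

Lemma plane_mulE (c : R[i]) (p : plane) :
  (plane_mul c p).1 +i* (plane_mul c p).2 = (c * (p.1 +i* p.2))%R.
Proof. by case: c => u v; rewrite /plane_mul /=; simpc; congr (_ +i* _); rewrite /=; ring. Qed.

Lemma plane_mulM (c d : R[i]) : plane_mul (c * d)%R =1 plane_mul c \o plane_mul d.
Proof.
by case: c => u v; case: d => w z p; rewrite /plane_mul; simpc => /=; congr pair; ring.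
Qed.

Lemma measurable_plane_mul (c : R[i]) : measurable_fun setT (plane_mul c).
Proof.
apply: measurable_fun_pair.
  by apply: measurable_funB; apply: measurable_funM => //.
by apply: measurable_funD; apply: measurable_funM => //.
Qed.

Lemma measurable_plane_mul_preimage (c : R[i]) (A : set plane) :
  measurable A -> measurable (plane_mul c @^-1` A).
Proof. by move=> mA; rewrite -[X in measurable X]setTI; exact: measurable_plane_mul. Qed.

(* Multiplication by [u + i v] with [u != 0] is a product of two shears; for
   [u = 0] use [i v = (1 + i) (v / 2) (1 + i)]. *)
Lemma lebesgue2_plane_mul (c : R[i]) (A : set plane) : c != 0%R -> measurable A ->
  (cabs c ^+ 2)%:E * lam2 (plane_mul c @^-1` A) = lam2 A.
Proof.
have H (u v : R) (B : set plane) : u != 0%R -> measurable B ->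
    (cabs (u +i* v) ^+ 2)%:E * lam2 (plane_mul (u +i* v) @^-1` B) = lam2 B.
  move=> u0 mB.
  have n0 : (0 < u ^+ 2 + v ^+ 2)%R.
    by rewrite ltr_pwDl ?sqr_ge0// exprn_even_gt0.
  (* The slopes [u] and [(u ^+ 2 + v ^+ 2) / u] of the two shears multiply to [|u + i v|^2], the
     determinant of the multiplication. *)
  have a0 : ((u ^+ 2 + v ^+ 2) / u != 0)%R.
    by rewrite mulf_neq0 ?invr_eq0// gt_eqF.
  rewrite -(@lebesgue2_shear2 _ (v / u) B a0 mB).
  set C := (X in _ = _ * lam2 X).
  have mC : measurable C.
    by rewrite -[X in measurable X]setTI; exact: measurable_shear2.
  rewrite -(@lebesgue2_shear1 u (- v) C u0 mC) muleA -EFinM; congr (_%:E * lam2 _).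
    rewrite cabs_sqr /= normrM normfV (gtr0_norm n0) mulfVK//.
    by rewrite normr_eq0.
  have e p : (v / u * (u * p.1 + - v * p.2) + (u ^+ 2 + v ^+ 2) / u * p.2)%R =
      (v * p.1 + u * p.2)%R :> R by field.
  by rewrite /C; apply/seteqP; split => p; rewrite /plane_mul /= e mulNr.
case: c => u v c0 mA.
have [u0|u0] := eqVneq u 0%R; last exact: H.
have v0 : v != 0%R by move: c0; rewrite u0 eq_complex /= eqxx.
pose d1 : R[i] := (1 +i* 1)%R; pose d2 : R[i] := ((v / 2) +i* (v / 2))%R.
have -> : u +i* v = (d1 * d2)%R.
  by rewrite u0 /d1 /d2; simpc; congr (_ +i* _); lra.
have e : plane_mul (d1 * d2)%R @^-1` A = plane_mul d2 @^-1` (plane_mul d1 @^-1` A).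
  by apply/seteqP; split => p /=; rewrite plane_mulM.
rewrite e cabsM exprMn EFinM -muleA H ?H ?oner_neq0//.
- by rewrite mulf_neq0// invr_eq0.
- exact: measurable_plane_mul_preimage.
Qed.

End LebesguePlane.

(** * Image of planar measure under the squared modulus *)

Section RadialPushforward.
Local Open Scope ereal_scope.
Context {R : realType}.
Notation lam := (@lebesgue_measure R).
Notation RR := (measurableTypeR R).
Notation plane := (RR * RR)%type.
Notation lam2 := (@lebesgue2 R).

Lemma lebesgue2_rect (A B : set RR) : measurable A -> measurable B ->
  lam2 (A `*` B) = lam A * lam B.
Proof. by move=> mA mB; rewrite /lebesgue2 product_measure1E. Qed.

(** With the squared modulus, unlike the modulus, the image of planar measure has constant density
    on the positive half-line. *)
Definition sqdist (p : plane) : RR := (p.1 ^+ 2 + p.2 ^+ 2)%R.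

Lemma measurable_sqdist : measurable_fun setT sqdist.
Proof.
by apply: measurable_funD; apply: measurable_funX => //; exact: measurable_snd.
Qed.

Lemma measurable_sqdist_preimage (A : set RR) :
  measurable A -> measurable (sqdist @^-1` A).
Proof. by move=> mA; rewrite -[X in measurable X]setTI; exact: measurable_sqdist. Qed.

Lemma sqdist_ge0 p : (0 <= sqdist p)%R.
Proof. by rewrite addr_ge0// sqr_ge0. Qed.

Lemma sqdistE p : sqdist p = (cabs (p.1 +i* p.2) ^+ 2)%R.
Proof. by rewrite cabs_sqr. Qed.

Lemma sqdist_mul (c : R[i]) p : sqdist (plane_mul c p) = (cabs c ^+ 2 * sqdist p)%R.
Proof. by rewrite !sqdistE plane_mulE cabsM exprMn. Qed.

Definition unit_disc_measure : \bar R := lam2 (sqdist @^-1` `]-oo, 1%R]).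

Let mle (r : R) : measurable (sqdist @^-1` `]-oo, r]).
Proof. exact: measurable_sqdist_preimage. Qed.

Lemma unit_disc_measure_fin : unit_disc_measure < +oo.
Proof.
have mI : measurable (`[(-1)%R, 1%R]%classic : set RR) by [].
apply: (@le_lt_trans _ _ (lam2 (`[(-1)%R, 1%R]%classic `*` `[(-1)%R, 1%R]%classic))).
  apply: le_measure; rewrite ?inE//; first exact: measurableX.
  move=> -[x y] /=; rewrite !in_itv /= /sqdist /= => h.
  by have := sqr_ge0 x; have := sqr_ge0 y; split; apply/andP; split; nra.
rewrite lebesgue2_rect// !lebesgue_measure_itv /= !lte_fin.
by rewrite ifT; [rewrite -EFinB -EFinM ltry|lra].
Qed.

Lemma unit_disc_measure_gt0 : 0 < unit_disc_measure.
Proof.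
have mI : measurable (`[0%R, (1/2)%R]%classic : set RR) by [].
apply: (@lt_le_trans _ _ (lam2 (`[0%R, (1/2)%R]%classic `*` `[0%R, (1/2)%R]%classic))).
  rewrite lebesgue2_rect// !lebesgue_measure_itv /= !lte_fin.
  by rewrite ifT; [rewrite -EFinB -EFinM lte_fin; lra|lra].
apply: le_measure; rewrite ?inE//; first exact: measurableX.
by move=> -[x y] /=; rewrite !in_itv /= /sqdist /= => -[/andP[? ?] /andP[? ?]]; nra.
Qed.

(* The value [pi] of [disc_area] is not needed. *)
Definition disc_area : R := fine unit_disc_measure.

Lemma disc_areaE : unit_disc_measure = disc_area%:E.
Proof.
by rewrite fineK// ge0_fin_numE ?unit_disc_measure_fin// ltW// unit_disc_measure_gt0.
Qed.

Lemma disc_area_gt0 : (0 < disc_area)%R.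
Proof. by rewrite -lte_fin -disc_areaE unit_disc_measure_gt0. Qed.

Lemma lebesgue2_disc (r : R) :
  lam2 (sqdist @^-1` `]-oo, r]) = (Num.max r 0 * disc_area)%:E.
Proof.
case: (ltgtP r 0%R) => r0.
- rewrite mul0r (_ : _ @^-1` _ = set0) ?measure0//.
  apply/seteqP; split => p //=; rewrite in_itv /= => h.
  by have := sqdist_ge0 p; rewrite leNgt (le_lt_trans h r0).
- pose c : R[i] := ((Num.sqrt r)^-1)%:C%R.
  have s0 : (0 < Num.sqrt r)%R by rewrite sqrtr_gt0.
  have c2 : (cabs c ^+ 2 = r^-1)%R.
    by rewrite /c cabs_real ger0_norm ?invr_ge0 ?ltW// exprVn sqr_sqrtr// ltW.
  have c0 : c != 0%R by rewrite -cabs_gt0 /c cabs_real normr_gt0 invr_neq0// gt_eqF.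
  have e : sqdist @^-1` `]-oo, r] = plane_mul c @^-1` (sqdist @^-1` `]-oo, 1%R]).
    apply/seteqP; split => p /=; rewrite !in_itv /= sqdist_mul c2;
      by rewrite ler_pdivrMl// mulr1.
  have := lebesgue2_plane_mul c0 (mle 1).
  rewrite -e c2 -/unit_disc_measure disc_areaE => h.
  rewrite EFinM -h muleA -EFinM divff ?mul1e//.
  by rewrite gt_eqF.
- rewrite r0 mul0r (_ : _ @^-1` _ = [set 0%R] `*` [set 0%R]).
    by rewrite lebesgue2_rect// lebesgue_measure_set1 mul0e.
  apply/seteqP; split => -[x y] /=; rewrite in_itv /= /sqdist /=.
    have := sqr_ge0 x; have := sqr_ge0 y => hy hx h.
    have hx0 : (x ^+ 2 = 0)%R by lra.
    have hy0 : (y ^+ 2 = 0)%R by lra.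
    by split; apply/eqP; [rewrite -sqrf_eq0 hx0|rewrite -sqrf_eq0 hy0].
  by move=> [-> ->]; rewrite expr0n /= addr0.
Qed.

(* By scaling, the measure of a disc is linear in its squared radius. *)
Lemma lebesgue2_sqdist_preimage (B : set RR) : measurable B ->
  B `<=` `]0%R, +oo[ -> lam2 (sqdist @^-1` B) = disc_area%:E * lam B.
Proof.
move=> mB B0.
pose p : {measure set RR -> \bar R} :=
  measure_function_pushforward__canonical__measure_function_Measure lam2 measurable_sqdist.
have a0 : (0 <= disc_area^-1)%R by rewrite invr_ge0 ltW ?disc_area_gt0.
pose m1 : {measure set RR -> \bar R} := mscale (NngNum a0) p.
(* The rescaled image measure has no mass on negative numbers. Adding [lam] restricted to []-oo, 0]]
   gives a measure that agrees with [lam] on every interval, so uniqueness on the whole line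
   applies. *)
have mN : measurable (`]-oo, 0%R]%classic : set RR) by [].
pose m2 : {measure set RR -> \bar R} := mrestr lam mN.
have da := disc_area_gt0.
have H : forall A, measurable A -> lam A = measure_add m1 m2 A.
  apply: lebesgue_measure_unique => _ [[a b] _ <-].
  rewrite [RHS](measure_addE m1 m2) /m1 /m2 /= /mscale /mrestr /p /= /pushforward /=.
  rewrite [X in _ + lam X](_ : _ = `]a, Num.min b 0%R]%classic); last first.
    by apply/seteqP; split => x /=; rewrite !in_itv /= le_min;
      [move=> [/andP[-> ->] ->]|move=> /and3P[-> -> ->]].
  have [ab|ba] := ltP a b; last first.
    rewrite set_itv_ge ?preimage_set0 ?measure0 ?mule0 ?add0e -?leNgt ?bnd_simp -?leNgt//.
    by rewrite set_itv_ge ?measure0// bnd_simp -leNgt ge_min ba.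
  have mab : lam2 (sqdist @^-1` `]a, b]) = ((Num.max b 0 - Num.max a 0) * disc_area)%:E.
    have -> : sqdist @^-1` `]a, b] =
        (sqdist @^-1` `]-oo, b]) `\` (sqdist @^-1` `]-oo, a]).
      apply/seteqP; split => x /=; rewrite !in_itv /=.
        by move=> /andP[h ->]; split => //; apply/negP; rewrite -ltNge.
      by move=> [-> /negP]; rewrite -ltNge andbT.
    transitivity (lam2 (sqdist @^-1` `]-oo, b]) -
        lam2 ((sqdist @^-1` `]-oo, b]) `&` (sqdist @^-1` `]-oo, a]))).
      have fb : lam2 (sqdist @^-1` `]-oo, b]) < +oo by rewrite lebesgue2_disc ltry.
      exact: measureD.
    rewrite setIidr; last first.
      by move=> x /=; rewrite !in_itv /= => /le_trans; apply; exact: ltW.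
    by rewrite !lebesgue2_disc -EFinB mulrBl.
  rewrite mab !lebesgue_measure_itv /= !lte_fin ab -EFinM.
  rewrite mulrCA mulVf ?gt_eqF// mulr1.
  have [b0|b0] := leP b 0%R; have [a0'|a0'] := leP a 0%R => /=.
  - by rewrite ab subrr add0e.
  - by move: (lt_le_trans a0' (le_trans (ltW ab) b0)); rewrite ltxx.
  - case: ifPn => h; rewrite ?adde0 -!EFinD; congr EFin; first lra.
    by move: h; rewrite -leNgt => h; lra.
  - rewrite ifF ?adde0 -?EFinD//.
    by apply/negbTE; rewrite -leNgt ltW.
have := H _ mB.
rewrite [X in _ = X](measure_addE m1 m2) /m1 /m2 /= /mscale /mrestr /p /= /pushforward /=.
rewrite [X in _ + lam X](_ : _ = set0) ?measure0 ?adde0 => [->|].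
  by rewrite muleA -EFinM divff ?mul1e// gt_eqF.
apply/seteqP; split => x //= [/B0 /=]; rewrite !in_itv /= andbT => h1 h2.
by move: (lt_le_trans h1 h2); rewrite ltxx.
Qed.

End RadialPushforward.

(** * Integrals of complex functions *)

Section ReIm.
Context {R : realType}.
Implicit Types z w : R[i].
Lemma cReD z w : complex.Re (z + w) = complex.Re z + complex.Re w.
Proof. by case: z; case: w. Qed.
Lemma cImD z w : complex.Im (z + w) = complex.Im z + complex.Im w.
Proof. by case: z; case: w. Qed.
Lemma cReM z w : complex.Re (z * w) =
  complex.Re z * complex.Re w - complex.Im z * complex.Im w.
Proof. by case: z; case: w. Qed.
Lemma cImM z w : complex.Im (z * w) =
  complex.Re z * complex.Im w + complex.Im z * complex.Re w.
Proof. by case: z => a b; case: w => c d. Qed.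
Lemma cReJ z : complex.Re z^* = complex.Re z. Proof. by case: z. Qed.
Lemma cImJ z : complex.Im z^* = - complex.Im z. Proof. by case: z. Qed.
Lemma complex_ext z w : complex.Re z = complex.Re w -> complex.Im z = complex.Im w -> z = w.
Proof. by case: z => a b; case: w => c d /= -> ->. Qed.
End ReIm.

Section ComplexIntegral.
Context d (T : measurableType d) (R : realType) (m : {measure set T -> \bar R}).
Variables (D : set T) (mD : measurable D).
Implicit Types f g h : T -> R[i].

Definition Cmeasurable f :=
  measurable_fun D (@complex.Re R \o f) /\ measurable_fun D (@complex.Im R \o f).

Definition Cintegrable f :=
  m.-integrable D (EFin \o (@complex.Re R \o f)) /\
  m.-integrable D (EFin \o (@complex.Im R \o f)).

(** Shaped so that [innerL2] unfolds to [Cint] of [f] times the conjugate of [g], as [sqnormL2]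
    unfolds to [sqint]. *)
Definition Cint f : R[i] :=
  (\int[m]_(x in D) complex.Re (f x)) +i* (\int[m]_(x in D) complex.Im (f x)).

Definition sqint f : \bar R := (\int[m]_(x in D) (cabs (f x) ^+ 2)%:E)%E.

Definition L2 f := Cmeasurable f /\ (sqint f < +oo)%E.

Lemma Cmeasurable_cst c : Cmeasurable (fun=> c).
Proof. by split; exact: measurable_cst. Qed.

Lemma CmeasurableD f g : Cmeasurable f -> Cmeasurable g ->
  Cmeasurable (fun x => f x + g x).
Proof.
move=> [f1 f2] [g1 g2]; split.
  rewrite (_ : _ \o _ = (@complex.Re R \o f) \+ (@complex.Re R \o g)); first exact: measurable_funD.
  by apply/funext => x /=; rewrite cReD.
rewrite (_ : _ \o _ = (@complex.Im R \o f) \+ (@complex.Im R \o g)); first exact: measurable_funD.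
by apply/funext => x /=; rewrite cImD.
Qed.

Lemma CmeasurableM f g : Cmeasurable f -> Cmeasurable g ->
  Cmeasurable (fun x => f x * g x).
Proof.
move=> [f1 f2] [g1 g2]; split.
  rewrite (_ : _ \o _ = ((@complex.Re R \o f) \* (@complex.Re R \o g)) \-
      ((@complex.Im R \o f) \* (@complex.Im R \o g))).
    by apply: measurable_funB; exact: measurable_funM.
  by apply/funext => x /=; rewrite cReM.
rewrite (_ : _ \o _ = ((@complex.Re R \o f) \* (@complex.Im R \o g)) \+
    ((@complex.Im R \o f) \* (@complex.Re R \o g))).
  by apply: measurable_funD; exact: measurable_funM.
by apply/funext => x /=; rewrite cImM.
Qed.

Lemma CmeasurableJ f : Cmeasurable f -> Cmeasurable (fun x => (f x)^*).
Proof.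
move=> [f1 f2]; split.
  by rewrite (_ : _ \o _ = @complex.Re R \o f)//; apply/funext => x /=; rewrite cReJ.
rewrite (_ : _ \o _ = \- (@complex.Im R \o f)); first exact: measurable_funN.
by apply/funext => x /=; rewrite cImJ.
Qed.

Lemma Cmeasurable_cabs2 f : Cmeasurable f ->
  measurable_fun D (fun x => (cabs (f x) ^+ 2)%:E).
Proof.
move=> [f1 f2]; apply/measurable_EFinP.
rewrite (_ : (fun _ => _) = ((@complex.Re R \o f) \* (@complex.Re R \o f)) \+
    ((@complex.Im R \o f) \* (@complex.Im R \o f))).
  by apply: measurable_funD; exact: measurable_funM.
by apply/funext => x /=; rewrite cabs_sqr !expr2.
Qed.

Lemma sqint_ge0 f : (0 <= sqint f)%E.
Proof. by apply: integral_ge0 => x _; rewrite lee_fin sqr_ge0. Qed.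

Lemma sqint_fineK f : (sqint f < +oo)%E -> sqint f = (fine (sqint f))%:E.
Proof. by move=> h; rewrite fineK// ge0_fin_numE// sqint_ge0. Qed.

Lemma integrable_cabs2 f : L2 f -> m.-integrable D (EFin \o (fun x => cabs (f x) ^+ 2)).
Proof.
move=> [mf sf]; apply/integrableP; split; first exact: Cmeasurable_cabs2.
by apply: le_lt_trans sf; apply: ge0_le_integral => //;
  [apply: measurableT_comp => //; exact: Cmeasurable_cabs2|exact: Cmeasurable_cabs2|
   move=> x _ /=; rewrite lee_fin ger0_norm// sqr_ge0].
Qed.

Lemma cabsMJ_le f g x : cabs (f x * (g x)^*) <= cabs (f x) ^+ 2 + cabs (g x) ^+ 2.
Proof.
rewrite cabsM cabs_conj; have := cabs_ge0 (f x); have := cabs_ge0 (g x).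
set u := cabs _; set v := cabs _ => u0 v0.
by have := sqr_ge0 (u - v); have := mulr_ge0 u0 v0; nra.
Qed.

Lemma CintegrableMJ f g : L2 f -> L2 g -> Cintegrable (fun x => f x * (g x)^*).
Proof.
move=> lf lg.
have [m1 m2] := CmeasurableM lf.1 (CmeasurableJ lg.1).
have ifg := integrableD mD (integrable_cabs2 lf) (integrable_cabs2 lg).
split; apply: (le_integrable mD _ _ ifg).
- by apply/measurable_EFinP.
- move=> x _ /=; rewrite lee_fin [leRHS]ger0_norm ?addr_ge0 ?sqr_ge0//.
  by apply: le_trans (cabsMJ_le f g x); exact: le_Re_cabs.
- by apply/measurable_EFinP.
- move=> x _ /=; rewrite lee_fin [leRHS]ger0_norm ?addr_ge0 ?sqr_ge0//.
  by apply: le_trans (cabsMJ_le f g x); exact: le_Im_cabs.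
Qed.

Lemma L2D f g : L2 f -> L2 g -> L2 (fun x => f x + g x).
Proof.
move=> lf lg; split; first exact: CmeasurableD lf.1 lg.1.
have ifg := integrableZl mD 2 (integrableD mD (integrable_cabs2 lf) (integrable_cabs2 lg)).
apply: le_lt_trans (integrable_lty mD ifg).
apply: ge0_le_integral => //.
- by move=> x _; rewrite lee_fin sqr_ge0.
- by apply: Cmeasurable_cabs2; exact: CmeasurableD lf.1 lg.1.
- by apply: (measurable_int m); exact: ifg.
- move=> x _; rewrite lee_fin /=.
  have := cabsD (f x) (g x); have := cabs_ge0 (f x + g x).
  have := cabs_ge0 (f x); have := cabs_ge0 (g x).
  set u := cabs _; set v := cabs _; set w := cabs _ => u0 v0 w0 h.
  have : w ^+ 2 <= (v + u) ^+ 2 by rewrite ler_pXn2r ?nnegrE ?addr_ge0.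
  by have := sqr_ge0 (u - v); nra.
Qed.

Lemma L2Z c f : L2 f -> L2 (fun x => c * f x).
Proof.
move=> [mf sf]; split; first by apply: CmeasurableM => //; exact: Cmeasurable_cst.
have i := integrableZl mD (cabs c ^+ 2) (integrable_cabs2 (conj mf sf)).
apply: le_lt_trans (integrable_lty mD i).
by apply: (@eq_ind _ _ (fun z => (z <= _)%E) (lexx _)); apply: eq_integral => x _;
  rewrite /= -EFinM cabsM exprMn.
Qed.

Lemma CintegrableZ c f : Cintegrable f -> Cintegrable (fun x => c * f x).
Proof.
move=> [f1 f2]; split.
  apply: eq_integrable (integrableB mD (integrableZl mD (complex.Re c) f1)
    (integrableZl mD (complex.Im c) f2)) => // x _ /=.
  by rewrite cReM.
apply: eq_integrable (integrableD mD (integrableZl mD (complex.Re c) f2)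
  (integrableZl mD (complex.Im c) f1)) => // x _ /=.
by rewrite cImM.
Qed.

Lemma CintD f g : Cintegrable f -> Cintegrable g ->
  Cint (fun x => f x + g x) = Cint f + Cint g.
Proof.
move=> [f1 f2] [g1 g2]; rewrite /Cint; simpc.
rewrite -!RintegralD//; congr (_ +i* _); apply: eq_Rintegral => x _.
  by rewrite cReD.
by rewrite cImD.
Qed.

Lemma CintZ c f : Cintegrable f -> Cint (fun x => c * f x) = c * Cint f.
Proof.
move=> [f1 f2]; rewrite /Cint; case: c => u v; simpc.
rewrite -!RintegralZl// -RintegralB//; last 2 first.
- exact: (integrableZl mD u f1).
- exact: (integrableZl mD v f2).
rewrite -RintegralD//; last 2 first.
- exact: (integrableZl mD u f2).
- exact: (integrableZl mD v f1).
congr (_ +i* _); apply: eq_Rintegral => x _; first by rewrite cReM.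
by rewrite cImM.
Qed.

Lemma eq_Cint f g : {in D, f =1 g} -> Cint f = Cint g.
Proof.
by move=> fg; rewrite /Cint; congr (_ +i* _); apply: eq_Rintegral => x xD; rewrite fg.
Qed.

(* Integrating [2 t Re (u^* f g^* ) <= |f|^2 + t^2 |g|^2], where [u] is the
   phase of [Cint (f g^* )], and optimising over [t]. *)
Lemma Cauchy_Schwarz f g : L2 f -> L2 g ->
  cabs (Cint (fun x => f x * (g x)^*)) ^+ 2 <= fine (sqint f) * fine (sqint g).
Proof.
move=> lf lg; set I := Cint _; set X := fine _; set Y := fine _.
have X0 : 0 <= X by apply: fine_ge0; exact: sqint_ge0.
have Y0 : 0 <= Y by apply: fine_ge0; exact: sqint_ge0.
have [->|I0] := eqVneq I 0; first by rewrite cabs0 expr0n /= mulr_ge0.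
have c0 : 0 < cabs I by rewrite cabs_gt0.
have H (t : R) : 0 <= t -> 2 * t * cabs I <= X + t ^+ 2 * Y.
  move=> t0.
  have [i1 i2] := CintegrableMJ lf lg.
  pose u : R[i] := (cabs I)^-1%:C * I^*.
  have cu : cabs u = 1.
    by rewrite cabsM cabs_real cabs_conj normfV ger0_norm ?cabs_ge0// mulVf// gt_eqF.
  have i3 := CintegrableZ u (CintegrableMJ lf lg).
  have e : cabs I = \int[m]_(x in D) complex.Re (u * (f x * (g x)^*)).
    have e0 := CintZ u (CintegrableMJ lf lg); rewrite -/I in e0.
    have eu : u * I = (cabs I)%:C.
      rewrite /u -mulrA [I^* * I]mulrC -sqr_normc norm_cabs -rmorphXn -rmorphM /=.
      by congr (_%:C); rewrite expr2 mulrA mulVf ?mul1r// gt_eqF.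
    rewrite eu in e0.
    by have /= <- := congr1 (@complex.Re R) e0.
  have eX : X = \int[m]_(x in D) (cabs (f x) ^+ 2) by [].
  have eY : Y = \int[m]_(x in D) (cabs (g x) ^+ 2) by [].
  have if2 := integrable_cabs2 lf; have ig2 := integrable_cabs2 lg.
  rewrite e eX eY -!RintegralZl//; last exact: i3.1.
  rewrite -RintegralD//; last exact: (integrableZl mD (t ^+ 2) ig2).
  apply: le_Rintegral => //.
  - exact: (integrableZl mD (2 * t) i3.1).
  - exact: (integrableD mD if2 (integrableZl mD (t ^+ 2) ig2)).
  move=> x _.
  have := le_Re_cabs (u * (f x * (g x)^*)).
  rewrite cabsM cu mul1r cabsM cabs_conj => /(le_trans (ler_norm _)).
  set a := complex.Re _; set b := cabs (f x); set c := cabs (g x) => h.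
  have : 2 * t * a <= 2 * t * (b * c) by rewrite ler_wpM2l// mulr_ge0.
  by have := sqr_ge0 (b - t * c); nra.
(* The optimal [t] is [|I| / Y]. If [Y = 0], the inequality bounds [2 t |I|] by [X] for all
   [t >= 0], which [t = (X + 1) / |I|] contradicts. *)
have [Y1|Y1] := eqVneq Y 0.
  have := H ((X + 1) / cabs I) (divr_ge0 (addr_ge0 X0 ler01) (ltW c0)).
  by rewrite Y1 mulr0 -mulrA mulfVK ?gt_eqF//; lra.
have Yp : 0 < Y by rewrite lt_def Y1.
have := H (cabs I / Y) (divr_ge0 (ltW c0) Y0).
rewrite -(ler_pM2r Yp).
have -> : 2 * (cabs I / Y) * cabs I * Y = 2 * cabs I ^+ 2.
  by field; rewrite gt_eqF.
have -> : (X + (cabs I / Y) ^+ 2 * Y) * Y = X * Y + cabs I ^+ 2.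
  by field; rewrite gt_eqF.
lra.
Qed.

End ComplexIntegral.

(** * Integrals of products in separate variables *)

Section ProductIntegral.
Local Open Scope ereal_scope.
Context d1 d2 (T1 : measurableType d1) (T2 : measurableType d2) (R : realType).
Variables (m1 : {sigma_finite_measure set T1 -> \bar R})
  (m2 : {sigma_finite_measure set T2 -> \bar R}).

Lemma ge0_integral_prodT (F : T1 -> \bar R) (G : T2 -> \bar R) :
  measurable_fun setT F -> measurable_fun setT G ->
  (forall x, 0 <= F x) -> (forall x, 0 <= G x) ->
  \int[m1 \x m2]_p (F p.1 * G p.2) = (\int[m1]_x F x) * (\int[m2]_y G y).
Proof.
move=> mF mG F0 G0; rewrite fubini_tonelli1//; last 2 first.
- by apply: emeasurable_funM; [exact: measurableT_comp|exact: measurableT_comp].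
- by move=> x /=; rewrite mule_ge0.
rewrite -ge0_integralZr//; last exact: integral_ge0.
by apply: eq_integral => x _; rewrite -ge0_integralZl.
Qed.

(** Extension by zero respects products, which reduces rectangles to the whole product space, where
    the theorems of Tonelli and Fubini are applied. *)
Lemma patch_prod (D : set T1) (A : set T2) (F : T1 -> \bar R) (G : T2 -> \bar R) p :
  ((fun p => F p.1 * G p.2) \_ (D `*` A)) p = (F \_ D) p.1 * (G \_ A) p.2.
Proof.
rewrite !patchE in_setX; case: ifP => [/andP[-> ->]//|].
by case: ifP => /= _; [move=> ->; rewrite mule0|rewrite mul0e].
Qed.

Lemma ge0_integral_prod (D : set T1) (A : set T2) (F : T1 -> \bar R) (G : T2 -> \bar R) :
  measurable D -> measurable A -> measurable_fun D F -> measurable_fun A G ->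
  (forall x, 0 <= F x) -> (forall x, 0 <= G x) ->
  \int[m1 \x m2]_(p in D `*` A) (F p.1 * G p.2) =
  (\int[m1]_(x in D) F x) * (\int[m2]_(y in A) G y).
Proof.
move=> mD mA mF mG F0 G0.
rewrite integral_mkcond [X in _ = X * _]integral_mkcond [X in _ = _ * X]integral_mkcond.
rewrite -ge0_integral_prodT//.
- by apply: eq_integral => p _; exact: patch_prod.
- exact/(measurable_restrictT F mD).
- exact/(measurable_restrictT G mA).
- by move=> x; rewrite patchE; case: ifP.
- by move=> x; rewrite patchE; case: ifP.
Qed.

(** Tonelli's theorem for the absolute values gives integrability, which then permits Fubini's
    theorem. *)
Lemma integrable_prod (D : set T1) (A : set T2) (F : T1 -> R) (G : T2 -> R) :
  measurable D -> measurable A ->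
  m1.-integrable D (EFin \o F) -> m2.-integrable A (EFin \o G) ->
  (m1 \x m2).-integrable (D `*` A) (EFin \o (fun p => F p.1 * G p.2)%R) /\
  \int[m1 \x m2]_(p in D `*` A) (F p.1 * G p.2)%:E =
  (\int[m1]_(x in D) (F x)%:E) * (\int[m2]_(y in A) (G y)%:E).
Proof.
move=> mD mA iF iG.
have mDA : measurable (D `*` A) by exact: measurableX.
pose F' : T1 -> \bar R := (EFin \o F) \_ D; pose G' : T2 -> \bar R := (EFin \o G) \_ A.
have iF' : m1.-integrable setT F' by apply/(integrable_mkcond _ mD).
have iG' : m2.-integrable setT G' by apply/(integrable_mkcond _ mA).
have mF' := measurable_int m1 iF'; have mG' := measurable_int m2 iG'.
have mFG : measurable_fun setT (fun p : T1 * T2 => F' p.1 * G' p.2).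
  by apply: emeasurable_funM; [exact: measurableT_comp|exact: measurableT_comp].
have iFG : (m1 \x m2).-integrable setT (fun p : T1 * T2 => F' p.1 * G' p.2).
  apply/integrableP; split => //.
  under eq_integral do rewrite abseM.
  rewrite (@ge0_integral_prodT (abse \o F') (abse \o G'))//; last 4 first.
  - by apply: measurableT_comp.
  - by apply: measurableT_comp.
  - by move=> x /=.
  - by move=> x /=.
  have /integrableP[_ f1] := iF'; have /integrableP[_ g1] := iG'.
  apply: lte_mul_pinfty => //; first by apply: integral_ge0 => x _ /=.
  by rewrite ge0_fin_numE//; apply: integral_ge0 => x _ /=.
have e p : F' p.1 * G' p.2 = ((EFin \o (fun p => F p.1 * G p.2)%R) \_ (D `*` A)) p.
  by rewrite -patch_prod; congr patch; apply/funext.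
split.
  apply/(integrable_mkcond _ mDA).
  by apply: eq_integrable iFG => // p _; rewrite e.
rewrite integral_mkcond [X in _ = X * _]integral_mkcond [X in _ = _ * X]integral_mkcond.
rewrite -/F' -/G'.
transitivity (\int[m1 \x m2]_p (F' p.1 * G' p.2)).
  by apply: eq_integral => p _; rewrite e.
rewrite -integral12_prod_meas1//.
have fG : \int[m2]_y G' y \is a fin_num by exact: integrable_fin_num.
rewrite -(fineK fG) -integralZr//.
apply: eq_integral => x _ /=; rewrite fineK//.
have Fx : F' x = (fine (F' x))%:E by rewrite /F' patchE; case: ifP.
by rewrite [in RHS]Fx -integralZl// /fubini_F /=; under [LHS]eq_integral do rewrite Fx.
Qed.

Lemma Rintegral_prod (D : set T1) (A : set T2) (F : T1 -> R) (G : T2 -> R) :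
  measurable D -> measurable A ->
  m1.-integrable D (EFin \o F) -> m2.-integrable A (EFin \o G) ->
  (\int[m1 \x m2]_(p in D `*` A) (F p.1 * G p.2) =
  (\int[m1]_(x in D) (F x)) * (\int[m2]_(y in A) (G y)))%R.
Proof.
move=> mD mA iF iG; rewrite {1}/Rintegral (integrable_prod mD mA iF iG).2.
by rewrite fineM//; exact: integrable_fin_num.
Qed.

Lemma Cint_prod (D : set T1) (A : set T2) (f : T1 -> R[i]) (g : T2 -> R[i]) :
  measurable D -> measurable A -> Cintegrable m1 D f -> Cintegrable m2 A g ->
  Cint (m1 \x m2) (D `*` A) (fun p => f p.1 * g p.2)%R = (Cint m1 D f * Cint m2 A g)%R.
Proof.
move=> mD mA [f1 f2] [g1 g2].
have mDA : measurable (D `*` A) by exact: measurableX.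
have /= e11 := Rintegral_prod mD mA f1 g1; have /= e22 := Rintegral_prod mD mA f2 g2.
have /= e12 := Rintegral_prod mD mA f1 g2; have /= e21 := Rintegral_prod mD mA f2 g1.
apply: complex_ext; rewrite ?cReM ?cImM /=.
  rewrite -e11 -e22 -RintegralB//; last 2 first.
  - exact: (integrable_prod mD mA f1 g1).1.
  - exact: (integrable_prod mD mA f2 g2).1.
  by apply: eq_Rintegral => p _; rewrite cReM.
rewrite -e12 -e21 -RintegralD//; last 2 first.
- exact: (integrable_prod mD mA f1 g2).1.
- exact: (integrable_prod mD mA f2 g1).1.
by apply: eq_Rintegral => p _; rewrite cImM.
Qed.

Lemma sqint_prod (D : set T1) (A : set T2) (f : T1 -> R[i]) (g : T2 -> R[i]) :
  measurable D -> measurable A -> Cmeasurable D f -> Cmeasurable A g ->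
  sqint (m1 \x m2) (D `*` A) (fun p => f p.1 * g p.2)%R = sqint m1 D f * sqint m2 A g.
Proof.
move=> mD mA mf mg; rewrite /sqint -ge0_integral_prod//.
- by apply: eq_integral => p _; rewrite cabsM exprMn EFinM.
- exact: Cmeasurable_cabs2.
- exact: Cmeasurable_cabs2.
- by move=> x; rewrite lee_fin sqr_ge0.
- by move=> x; rewrite lee_fin sqr_ge0.
Qed.

End ProductIntegral.

Lemma Cintegrable_measurable d (T : measurableType d) (R : realType)
    (m : {measure set T -> \bar R}) (D : set T) (f : T -> R[i]) :
  Cintegrable m D f -> Cmeasurable D f.
Proof. by move=> [f1 f2]; split; apply/measurable_EFinP; exact: (measurable_int m). Qed.

Lemma CmeasurableX d1 d2 (T1 : measurableType d1) (T2 : measurableType d2)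
    (R : realType) (D : set T1) (A : set T2) (f : T1 -> R[i]) (g : T2 -> R[i]) :
  measurable D -> measurable A -> Cmeasurable D f -> Cmeasurable A g ->
  Cmeasurable (D `*` A) (fun p => f p.1 * g p.2).
Proof.
move=> mD mA [f1 f2] [g1 g2].
have m1 : measurable_fun (D `*` A) (@fst T1 T2) by exact: measurable_funTS.
have m2 : measurable_fun (D `*` A) (@snd T1 T2).
  by apply: measurable_funTS; exact: measurable_snd.
apply: CmeasurableM; split.
- by apply: (measurable_comp mD _ f1 m1) => _ [p [Dp _] <-].
- by apply: (measurable_comp mD _ f2 m1) => _ [p [Dp _] <-].
- by apply: (measurable_comp mA _ g1 m2) => _ [p [_ Ap] <-].
- by apply: (measurable_comp mA _ g2 m2) => _ [p [_ Ap] <-].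
Qed.

Section CTransfer.
Context d1 d2 (X : measurableType d1) (Y : measurableType d2) (R : realType).
Variables (phi : X -> Y) (mphi : measurable_fun setT phi).
Variables (m : {measure set X -> \bar R}) (n : {measure set Y -> \bar R}).
Variables (D : set Y) (mD : measurable D).
Hypothesis mn : forall A, measurable A -> A `<=` D -> m (phi @^-1` A) = n A.

Lemma Cint_transfer (f : Y -> R[i]) : Cmeasurable D f ->
  Cint m (phi @^-1` D) (fun x => f (phi x)) = Cint n D f.
Proof.
move=> [f1 f2]; rewrite /Cint /Rintegral; congr (fine _ +i* fine _).
  by apply: (@integral_transfer _ _ _ _ _ _ mphi m n D (EFin \o (@complex.Re R \o f))) => //;
    apply/measurable_EFinP.
by apply: (@integral_transfer _ _ _ _ _ _ mphi m n D (EFin \o (@complex.Im R \o f))) => //;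
  apply/measurable_EFinP.
Qed.

Lemma sqint_transfer (f : Y -> R[i]) : Cmeasurable D f ->
  sqint m (phi @^-1` D) (fun x => f (phi x)) = sqint n D f.
Proof.
by move=> mf; apply: (integral_transfer mphi mD mn (Cmeasurable_cabs2 mf)).
Qed.

Lemma Cmeasurable_transfer (f : Y -> R[i]) : Cmeasurable D f ->
  Cmeasurable (phi @^-1` D) (fun x => f (phi x)).
Proof.
have mphiD : measurable_fun (phi @^-1` D) phi by exact: measurable_funTS.
move=> [f1 f2]; split.
  by apply: (measurable_comp mD _ f1 mphiD) => _ [x Dx <-].
by apply: (measurable_comp mD _ f2 mphiD) => _ [x Dx <-].
Qed.

End CTransfer.

(** * Integrals over annuli *)

Section RadialIntegrals.
Context {R : realType}.
Notation lam := (@lebesgue_measure R).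
Notation lam2 := (@lebesgue2 R).
Implicit Types (a b w mu : R) (F f : R -> R).

Lemma FTC_pos a b F f : 0 < a -> a < b ->
  (forall x : R, 0 < x -> is_derive x 1 F (f x)) ->
  (forall x : R, 0 < x -> {for x, continuous f}) ->
  lam.-integrable `]a, b[ (EFin \o f) /\
  (\int[lam]_(x in `]a, b[) (f x)%:E = (F b - F a)%:E)%E.
Proof.
move=> a0 ab dF cf; have b0 := lt_trans a0 ab.
have wf : {within `[a, b], continuous f}.
  apply: continuous_in_subspaceT => x; rewrite inE /= in_itv /= => /andP[ax _].
  exact/cf/(lt_le_trans a0).
have icc : lam.-integrable `[a, b] (EFin \o f).
  by apply: continuous_compact_integrable => //; exact: segment_compact.
have ioo : lam.-integrable `]a, b[ (EFin \o f).
  by apply: integrableS icc => //; exact: subset_itv_oo_cc.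
split => //.
rewrite -(@integral_itv_bndoo _ _ _ (EFin \o f) true false); last exact: measurable_int ioo.
rewrite EFinB -(continuous_FTC2 ab wf)//.
- have cF (x : R) : 0 < x -> {for x, continuous F}.
    move=> x0; apply: differentiable_continuous; apply/derivable1_diffP.
    by have [] := dF x x0.
  split; first by move=> x; rewrite in_itv /= => /andP[ax _]; have [] := dF x (lt_trans a0 ax).
    by apply: cvg_at_right_filter; exact: cF.
  by apply: cvg_at_left_filter; exact: cF.
- move=> x; rewrite in_itv /= => /andP[ax _].
  by rewrite derive1E; have [_ ->] := dF x (lt_trans a0 ax).
Qed.

Let dln (x : R) : 0 < x -> is_derive x 1 (@ln R) x^-1.
Proof. exact: is_derive1_ln. Qed.

Lemma continuous_ln_over w (g : R -> R) (x : R) : continuous g -> 0 < x ->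
  {for x, continuous (fun t => g (w * ln t) / t)}.
Proof.
move=> cg x0.
have c1 : w * ln t @[t --> x] --> w * ln x.
  by apply: cvgM; [exact: cvg_cst|exact: continuous_ln].
apply: cvgM; last by apply: cvgV; [rewrite gt_eqF|exact: cvg_id].
exact: (cvg_comp _ _ c1 (cg _)).
Qed.

(** In the variable [s = ln t] this is the integral of [cos (w s)] over []-mu, mu[]; an explicit
    antiderivative in [t] avoids the substitution. *)
Lemma integral_cos_ln w mu : w != 0 -> 0 < mu ->
  lam.-integrable `]expR (- mu), expR mu[ (EFin \o (fun t => cos (w * ln t) / t)) /\
  (\int[lam]_(t in `]expR (- mu), expR mu[) (cos (w * ln t) / t)%:E =
   (2 * sin (w * mu) / w)%:E)%E.
Proof.
move=> w0 mu0.
have [] := @FTC_pos (expR (- mu)) (expR mu) (fun t => sin (w * ln t) / w)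
  (fun t => cos (w * ln t) / t) _ _ _ _.
- exact: expR_gt0.
- by rewrite ltr_expR; lra.
- move=> x x0.
  have d1 : is_derive x 1 (fun t => w * ln t) (w / x).
    by have := is_deriveZ w (dln x0).
  have d2 := @is_derive1_comp _ _ _ x _ _ (is_derive_sin (w * ln x)) d1.
  have d3 := @is_deriveM _ _ (fun t => sin (w * ln t)) (cst w^-1) x 1 _ _ d2 (is_derive_cst _ _ _).
  apply: is_derive_eq d3 _; rewrite scaler0 add0r /=.
  rewrite /GRing.scale /=; field; rewrite w0 gt_eqF//.
- by move=> x x0; apply: continuous_ln_over => //; exact: continuous_cos.
move=> i ->; split => //; congr EFin.
rewrite !expRK mulrN sinN; ring.
Qed.

Lemma integral_sin_ln w mu : w != 0 -> 0 < mu ->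
  lam.-integrable `]expR (- mu), expR mu[ (EFin \o (fun t => sin (w * ln t) / t)) /\
  (\int[lam]_(t in `]expR (- mu), expR mu[) (sin (w * ln t) / t)%:E = 0)%E.
Proof.
move=> w0 mu0.
have [] := @FTC_pos (expR (- mu)) (expR mu) (fun t => cos (w * ln t) / - w)
  (fun t => sin (w * ln t) / t) _ _ _ _.
- exact: expR_gt0.
- by rewrite ltr_expR; lra.
- move=> x x0.
  have d1 : is_derive x 1 (fun t => w * ln t) (w / x).
    by have := is_deriveZ w (dln x0).
  have d2 := @is_derive1_comp _ _ _ x _ _ (is_derive_cos (w * ln x)) d1.
  have d3 := @is_deriveM _ _ (fun t => cos (w * ln t)) (cst (- w)^-1) x 1 _ _ d2 (is_derive_cst _ _ _).
  apply: is_derive_eq d3 _; rewrite scaler0 add0r /=.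
  rewrite /GRing.scale /=; field; rewrite w0 gt_eqF//.
- by move=> x x0; apply: continuous_ln_over => //; exact: continuous_sin.
move=> i ->; split => //; congr EFin.
by rewrite !expRK mulrN cosN subrr.
Qed.

Lemma integral_inv_ln mu : 0 < mu ->
  lam.-integrable `]expR (- mu), expR mu[ (EFin \o (fun t => t^-1)) /\
  (\int[lam]_(t in `]expR (- mu), expR mu[) (t^-1)%:E = (2 * mu)%:E)%E.
Proof.
move=> mu0.
have [] := @FTC_pos (expR (- mu)) (expR mu) (@ln R) (fun t => t^-1) _ _ _ _.
- exact: expR_gt0.
- by rewrite ltr_expR; lra.
- by move=> x x0; apply: cvgV; [rewrite gt_eqF|exact: cvg_id].
by move=> i ->; split => //; congr EFin; rewrite !expRK; ring.
Qed.

(** The integrand is [t^a]. Away from [0] its integral is at most the value at [b] of the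
    antiderivative [t^(a+1) / (a+1)], a bound that survives monotone convergence. *)
Lemma integral_powR_fin a b : -1 < a -> 0 < b ->
  (\int[lam]_(t in `]0%R, b[) (expR (a * ln t))%:E < +oo)%E.
Proof.
move=> a1 b0.
have a10 : 0 < a + 1 by lra.
(* Division by [n.+2] keeps the interval nondegenerate already for [n = 0]. *)
pose F n : set R := `]b / n.+2%:R, b[%classic.
have bn n : 0 < b / n.+2%:R by rewrite divr_gt0.
have Fb : `]0, b[%classic = \bigcup_n F n.
  apply/seteqP; split => x /=; rewrite /F.
    rewrite in_itv /= => /andP[x0 xb].
    exists (Num.bound (b / x)) => //=; rewrite in_itv /= xb andbT.
    rewrite ltr_pdivrMr// mulrC -ltr_pdivrMr//.
    have := archi_boundP (divr_ge0 (ltW b0) (ltW x0)); move=> /lt_trans; apply.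
    by rewrite ltr_nat ltnS leqnSn.
  by move=> [n _] /=; rewrite !in_itv /= => /andP[h ->]; rewrite (lt_trans (bn n) h).
have I n : (\int[lam]_(t in F n) (expR (a * ln t))%:E <= (expR ((a + 1) * ln b) / (a + 1))%:E)%E.
  have [] := @FTC_pos (b / n.+2%:R) b (fun t => expR ((a + 1) * ln t) / (a + 1))
    (fun t => expR (a * ln t)) _ _ _ _.
  - exact: bn.
  - by rewrite ltr_pdivrMr// ltr_pMr// ltr1n.
  - move=> x x0.
    have d1 : is_derive x 1 (fun t => (a + 1) * ln t) ((a + 1) / x).
      by have := is_deriveZ (a + 1) (dln x0).
    have d2 := @is_derive1_comp _ _ _ x _ _ (is_derive_expR ((a + 1) * ln x)) d1.
    have d3 := @is_deriveM _ _ (fun t => expR ((a + 1) * ln t)) (cst (a + 1)^-1) x 1 _ _ d2 (is_derive_cst _ _ _).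
    apply: is_derive_eq d3 _; rewrite scaler0 add0r /=.
    rewrite mulrDl mul1r expRD lnK ?posrE//.
    by rewrite /GRing.scale /=; field; rewrite !gt_eqF.
  - move=> x x0.
    have c1 : a * ln t @[t --> x] --> a * ln x.
      by apply: cvgM; [exact: cvg_cst|exact: continuous_ln].
    exact: (cvg_comp _ _ c1 (@continuous_expR R _)).
  move=> _ ->; rewrite lee_fin lerBlDr lerDl.
  by rewrite divr_ge0 ?expR_ge0// ltW.
have mF n : measurable (F n) by exact: measurable_itv.
have mE n : measurable_fun (F n) (fun t : R => (expR (a * ln t))%:E).
  apply/measurable_EFinP; apply: measurableT_comp => //.
  by apply: measurable_funM => //; exact: measurable_funTS.
have ndF : nondecreasing_seq F.
  apply/nondecreasing_seqP => n; apply/subsetPset => x; rewrite /F /= !in_itv /=.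
  move=> /andP[h ->]; rewrite andbT (le_lt_trans _ h)//.
  by rewrite ler_pM2l// lef_pV2 ?posrE// ler_nat.
have f0 n x : F n x -> (0 <= (expR (a * ln x))%:E)%E by rewrite lee_fin expR_ge0.
have cv := @ge0_nondecreasing_set_cvg_integral _ _ _ _ _ lam ndF mF mE f0.
rewrite Fb -(cvg_lim _ cv)//.
apply: (@le_lt_trans _ _ (expR ((a + 1) * ln b) / (a + 1))%:E); last by rewrite ltry.
apply: lime_le; first by apply/cvg_ex; eexists; exact: cv.
by apply: nearW => n; exact: I.
Qed.

End RadialIntegrals.

Section Rintegral_mscale.
Context d (T : measurableType d) (R : realType).
Variables (m : {measure set T -> \bar R}) (D : set T) (mD : measurable D).

Lemma Rintegral_mscale (k : {nonneg R}) (f : T -> R) :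
  m.-integrable D (EFin \o f) ->
  \int[mscale k m]_(x in D) f x = k%:num * \int[m]_(x in D) f x.
Proof.
move=> fi; have mf := measurable_int m fi.
have P := integrable_pos_fin_num mD fi; have N := integrable_neg_fin_num mD fi.
rewrite /Rintegral integralE [in RHS]integralE.
rewrite !ge0_integral_mscale//; last 2 first.
- exact: measurable_funeneg.
- exact: measurable_funepos.
by rewrite -(fineK P) -(fineK N) -!EFinM -!EFinB /= mulrBr.
Qed.

End Rintegral_mscale.

Section Annulus.
Context {R : realType}.
Notation lam := (@lebesgue_measure R).
Notation RR := (measurableTypeR R).
Notation plane := (RR * RR)%type.
Notation lam2 := (@lebesgue2 R).
Notation alpha := (@disc_area R).

Let alphan : {nonneg R} := NngNum (ltW (@disc_area_gt0 R)).

Definition annulus (mu : R) : set plane := sqdist @^-1` `]expR (- mu), expR mu[.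

Lemma measurable_annulus mu : measurable (annulus mu).
Proof. exact: measurable_sqdist_preimage. Qed.

Let transferA (I : set RR) : measurable I -> I `<=` `]0, +oo[ ->
  forall A, measurable A -> A `<=` I ->
  lam2 (sqdist @^-1` A) = mscale alphan lam A.
Proof.
by move=> mI I0 A mA AI; rewrite lebesgue2_sqdist_preimage//; exact: subset_trans I0.
Qed.

Let Imu0 (mu : R) : `]expR (- mu), expR mu[%classic `<=` (`]0, +oo[%classic : set RR).
Proof.
move=> x /=; rewrite !in_itv /= andbT => /andP[+ _].
by apply: lt_trans; exact: expR_gt0.
Qed.

(** Carried to the line and written in [s = ln t], this is [disc_area] times the integral of
    [e^{i w s}] over []-mu, mu[], whose imaginary part vanishes by oddness. The case [w = 0] is
    separate because the quotient by [w] would then be [0] by convention. *)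
Lemma Cint_annulus (w mu : R) : 0 < mu ->
  Cint lam2 (annulus mu)
    (fun p => (sqdist p)^-1%:C * cexp (0 +i* (w * ln (sqdist p)))) =
  (alpha * (if w == 0 then 2 * mu else 2 * sin (w * mu) / w))%:C.
Proof.
move=> mu0; pose I : set RR := `]expR (- mu), expR mu[%classic.
have mI : measurable I by exact: measurable_itv.
have ic : exists c s, [/\ lam.-integrable I (EFin \o (fun t => cos (w * ln t) / t)),
   lam.-integrable I (EFin \o (fun t => sin (w * ln t) / t)) ,
   \int[lam]_(t in I) (cos (w * ln t) / t) = c,
   \int[lam]_(t in I) (sin (w * ln t) / t) = s &
   c = (if w == 0 then 2 * mu else 2 * sin (w * mu) / w) /\ s = 0].
  case: ifPn => [/eqP w0|w0].
    have [i e] := integral_inv_ln mu0.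
    exists (2 * mu), 0; split => //.
    - by apply: eq_integrable i => // x _ /=; rewrite w0 mul0r cos0 mul1r.
    - apply: eq_integrable (integrable0 _ _) => // x _ /=.
      by rewrite w0 mul0r sin0 mul0r.
    - rewrite /Rintegral -[RHS]/(fine (2 * mu)%:E) -e; congr fine.
      by apply: eq_integral => x _; rewrite w0 mul0r cos0 mul1r.
    - rewrite /Rintegral integral0_eq// => x _.
      by rewrite w0 mul0r sin0 mul0r.
  have [i e] := integral_cos_ln w0 mu0; have [i' e'] := integral_sin_ln w0 mu0.
  by exists (2 * sin (w * mu) / w), 0; split => //; rewrite /Rintegral ?e ?e'.
have {ic} [c [s [i i' ec es [cE sE]]]] := ic.
pose h (t : RR) : R[i] := t^-1%:C * cexp (0 +i* (w * ln t)).
have hR t : complex.Re (h t) = cos (w * ln t) / t.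
  by rewrite /h cReM cexpE /= expR0 !mul1r mul0r subr0 mulrC.
have hI t : complex.Im (h t) = sin (w * ln t) / t.
  by rewrite /h cImM cexpE /= expR0 !mul1r mul0r addr0 mulrC.
have ch : Cmeasurable I h.
  split.
    apply/measurable_EFinP; apply: (measurable_int lam).
    by apply: eq_integrable i => // x _; congr EFin; exact: (esym (hR x)).
  apply/measurable_EFinP; apply: (measurable_int lam).
  by apply: eq_integrable i' => // x _; congr EFin; exact: (esym (hI x)).
rewrite -[LHS]/(Cint lam2 (sqdist @^-1` I) (fun p => h (sqdist p))).
rewrite (Cint_transfer (@measurable_sqdist R) mI (transferA mI (@Imu0 mu)) ch).
have jR : lam.-integrable I (EFin \o (@complex.Re R \o h)).
  by apply: eq_integrable i => // x _; congr EFin; exact: (esym (hR x)).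
have jI : lam.-integrable I (EFin \o (@complex.Im R \o h)).
  by apply: eq_integrable i' => // x _; congr EFin; exact: (esym (hI x)).
have eR : \int[lam]_(t in I) (@complex.Re R \o h) t = c.
  by rewrite -ec; apply: eq_Rintegral => x _; exact: hR.
have eI : \int[lam]_(t in I) (@complex.Im R \o h) t = s.
  by rewrite -es; apply: eq_Rintegral => x _; exact: hI.
apply: complex_ext.
  rewrite -[LHS]/(\int[mscale alphan lam]_(t in I) (@complex.Re R \o h) t).
  by rewrite Rintegral_mscale// eR cE.
rewrite -[LHS]/(\int[mscale alphan lam]_(t in I) (@complex.Im R \o h) t).
by rewrite Rintegral_mscale// eI sE mulr0.
Qed.

Lemma integral_annulus_inv (mu : R) : 0 < mu ->
  (\int[lam2]_(p in annulus mu) ((sqdist p)^-1)%:E = (alpha * (2 * mu))%:E)%E.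
Proof.
move=> mu0; pose I : set RR := `]expR (- mu), expR mu[%classic.
have mI : measurable I by exact: measurable_itv.
have [i e] := integral_inv_ln mu0.
have mf : measurable_fun I (fun t : RR => (t^-1)%:E) by exact: (measurable_int lam i).
rewrite -[LHS]/(\int[lam2]_(p in sqdist @^-1` I) (fun t => (t^-1)%:E) (sqdist p))%E.
rewrite (integral_transfer (@measurable_sqdist R) mI (transferA mI (@Imu0 mu)) mf).
rewrite ge0_integral_mscale//; first by rewrite e.
by move=> x /Imu0; rewrite /= in_itv /= andbT => x0; rewrite lee_fin invr_ge0 ltW.
Qed.

Lemma integral_disc_powR (a r : R) : -1 < a -> 0 < r ->
  (\int[lam2]_(p in sqdist @^-1` `]0%R, r[) (expR (a * ln (sqdist p)))%:E < +oo)%E.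
Proof.
move=> a1 r0; pose I : set RR := `]0%R, r[%classic.
have mI : measurable I by exact: measurable_itv.
have I0 : I `<=` `]0, +oo[ by move=> x /=; rewrite !in_itv /= andbT => /andP[].
have mf : measurable_fun I (fun t : RR => (expR (a * ln t))%:E).
  apply/measurable_EFinP; apply: measurableT_comp => //.
  by apply: measurable_funM => //; exact: measurable_funTS.
rewrite -[X in (X < _)%E]/(\int[lam2]_(p in sqdist @^-1` I) (fun t => (expR (a * ln t))%:E) (sqdist p))%E.
rewrite (integral_transfer (@measurable_sqdist R) mI (transferA mI I0) mf).
rewrite ge0_integral_mscale//.
by apply: lte_mul_pinfty => //; exact: integral_powR_fin.
Qed.

End Annulus.

(** * Flattening the worm domain *)

Section WormFlattening.
Context {R : realType}.
Notation lam := (@lebesgue_measure R).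
Notation RR := (measurableTypeR R).
Notation plane := (RR * RR)%type.
Notation lam2 := (@lebesgue2 R).

Definition toC (p : plane) : R[i] := p.1 +i* p.2.

Lemma toC_mul c p : toC (plane_mul c p) = c * toC p.
Proof. exact: plane_mulE. Qed.

Lemma log_sq_toC p : log_sq (toC p) = ln (sqdist p).
Proof. by rewrite /log_sq sqdistE. Qed.

Lemma sqdist_gt0 p : (0 < sqdist p) = (toC p != 0).
Proof. by rewrite sqdistE exprn_even_gt0 //= cabs_eq0. Qed.

Definition unit_disc1 : set plane := [set p | cabs (toC p - 1) ^+ 2 < 1].

Lemma measurable_unit_disc1 : measurable unit_disc1.
Proof.
have m : measurable_fun setT (fun p : plane => sqdist (p.1 - 1, p.2) : RR).
  apply: measurable_funD; apply: measurable_funX; last exact: measurable_snd.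
  by apply: measurable_funB => //.
rewrite (_ : unit_disc1 = (fun p : plane => sqdist (p.1 - 1, p.2) : RR) @^-1` `]-oo, 1[).
  by rewrite -[X in measurable X]setTI; apply: m.
apply/seteqP; split => p /=; rewrite /unit_disc1 /= in_itv /= sqdistE /= /toC;
  by rewrite (_ : (p.1 +i* p.2) - 1 = (p.1 - 1) +i* p.2)//; simpc.
Qed.

(** The condition [toC p != 0] matters: by the convention [ln 0 = 0] the origin satisfies the second
    condition for every positive [mu]. *)
Lemma annulusE mu p : annulus mu p <-> toC p != 0 /\ `|log_sq (toC p)| < mu.
Proof.
rewrite /annulus /= in_itv /= log_sq_toC -sqdist_gt0 ltr_norml; split.
  move=> /andP[h1 h2]; have q0 := lt_trans (expR_gt0 _) h1.
  by split => //; rewrite -ltr_expR -[X in _ && X]ltr_expR !lnK ?posrE// h1.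
by move=> [q0]; rewrite -ltr_expR -[X in _ && X]ltr_expR !lnK ?posrE.
Qed.

Definition worm_rot (p : plane) : R[i] := cexp (- (0 +i* ln (sqdist p))).

Definition worm_flat (p : plane * plane) : plane * plane :=
  (plane_mul (worm_rot p.2) p.1, p.2).

Lemma cabs_worm_rot p : cabs (worm_rot p) = 1.
Proof. by rewrite /worm_rot opp_imag cabs_cexp_i. Qed.

Lemma worm_zeta_flat p : worm_zeta (real_to_C2 p) = toC (worm_flat p).1.
Proof. by rewrite toC_mul /worm_zeta /= log_sq_toC mulrC. Qed.

Lemma worm_preimage mu :
  real_to_C2 @^-1` worm mu = worm_flat @^-1` (unit_disc1 `*` annulus mu).
Proof.
apply/seteqP; split => p /=.
  move=> [h1 h2 h3]; split; last by apply/annulusE.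
  by rewrite /unit_disc1 /= -worm_zeta_flat -worm_zetaB1.
move=> [h1 /annulusE[h2 h3]]; split => //.
by rewrite worm_zetaB1 worm_zeta_flat.
Qed.

Lemma measurable_ln_sqdist : measurable_fun setT (fun p : plane => ln (sqdist p)).
Proof. by apply: measurableT_comp => //; exact: measurable_sqdist. Qed.

Lemma measurable_worm_flat : measurable_fun setT worm_flat.
Proof.
have ms : measurable_fun setT (fun p : plane * plane => ln (sqdist p.2)).
  by apply: (measurableT_comp measurable_ln_sqdist); exact: measurable_snd.
have mc : measurable_fun setT (fun p : plane * plane => cos (- ln (sqdist p.2))).
  apply: (measurableT_comp (continuous_measurable_fun (@continuous_cos R))).
  exact: measurable_funN.
have mi : measurable_fun setT (fun p : plane * plane => sin (- ln (sqdist p.2))).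
  apply: (measurableT_comp (continuous_measurable_fun (@continuous_sin R))).
  exact: measurable_funN.
have m11 : measurable_fun setT (fun p : plane * plane => p.1.1).
  by apply: measurableT_comp => //; exact: measurable_fst.
have m12 : measurable_fun setT (fun p : plane * plane => p.1.2).
  by apply: (measurableT_comp measurable_snd); exact: measurable_fst.
apply: measurable_fun_pair; last exact: measurable_snd.
rewrite (_ : (fun _ => _) = (fun p : plane * plane =>
  ((cos (- ln (sqdist p.2)) * p.1.1 - sin (- ln (sqdist p.2)) * p.1.2,
   sin (- ln (sqdist p.2)) * p.1.1 + cos (- ln (sqdist p.2)) * p.1.2) : plane))); last first.
  by apply/funext => p; rewrite /plane_mul /worm_rot opp_imag cexpE /= expR0 !mul1r.
apply: measurable_fun_pair.
  by apply: measurable_funB; exact: measurable_funM.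
by apply: measurable_funD; exact: measurable_funM.
Qed.

Lemma lebesgue4_ysection (B : set (plane * plane)) : measurable B ->
  lebesgue4 B = (\int[lam2]_y lam2 (ysection B y))%E.
Proof.
move=> mB.
apply: (@product_measure_unique _ _ _ _ R lam2 lam2 (lam2 \x^ lam2)%E) => //.
by move=> X Y mX mY; exact: product_measure2E.
Qed.

(** The angle depends on the second coordinate only, so each y-section is rotated rigidly and keeps
    its measure. *)
Lemma lebesgue4_worm_flat (B : set (plane * plane)) : measurable B ->
  lebesgue4 (worm_flat @^-1` B) = lebesgue4 B.
Proof.
move=> mB.
have mF : measurable (worm_flat @^-1` B).
  by rewrite -[X in measurable X]setTI; exact: measurable_worm_flat.
rewrite [LHS](lebesgue4_ysection mF) [RHS](lebesgue4_ysection mB); apply: eq_integral => y _.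
have c0 : worm_rot y != 0 by exact: cexp_neq0.
rewrite -(lebesgue2_plane_mul c0 (measurable_ysection y mB)) cabs_worm_rot expr1n mul1e.
by congr (lam2 _); apply/seteqP; split => x; rewrite /ysection /= !inE.
Qed.

Lemma Cmeasurable_worm mu (f g : plane -> R[i]) :
  Cmeasurable unit_disc1 f -> Cmeasurable (annulus mu) g ->
  Cmeasurable (real_to_C2 @^-1` worm mu)
    (fun p => f (worm_flat p).1 * g (worm_flat p).2).
Proof.
move=> mf mg; rewrite worm_preimage.
have mD := measurable_unit_disc1; have mA := measurable_annulus mu.
apply: (Cmeasurable_transfer measurable_worm_flat (measurableX mD mA)
  (f := fun p => f p.1 * g p.2)).
exact: CmeasurableX.
Qed.

Lemma Cint_worm mu (f g : plane -> R[i]) :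
  Cintegrable lam2 unit_disc1 f -> Cintegrable lam2 (annulus mu) g ->
  Cint lebesgue4 (real_to_C2 @^-1` worm mu)
    (fun p => f (worm_flat p).1 * g (worm_flat p).2) =
  Cint lam2 unit_disc1 f * Cint lam2 (annulus mu) g.
Proof.
move=> fi gi.
have mD := measurable_unit_disc1; have mA := measurable_annulus mu.
rewrite worm_preimage.
rewrite (@Cint_transfer _ _ _ _ _ _ measurable_worm_flat lebesgue4 lebesgue4 _
  (measurableX mD mA) (fun A mA _ => lebesgue4_worm_flat mA) (fun p => f p.1 * g p.2)).
  exact: (@Cint_prod _ _ _ _ _ lam2 lam2).
by apply: CmeasurableX => //; apply: Cintegrable_measurable; eassumption.
Qed.

Lemma sqint_worm mu (f g : plane -> R[i]) :
  Cmeasurable unit_disc1 f -> Cmeasurable (annulus mu) g ->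
  sqint lebesgue4 (real_to_C2 @^-1` worm mu)
    (fun p => f (worm_flat p).1 * g (worm_flat p).2) =
  (sqint lam2 unit_disc1 f * sqint lam2 (annulus mu) g)%E.
Proof.
move=> mf mg.
have mD := measurable_unit_disc1; have mA := measurable_annulus mu.
rewrite worm_preimage.
rewrite (@sqint_transfer _ _ _ _ _ _ measurable_worm_flat lebesgue4 lebesgue4 _
  (measurableX mD mA) (fun A mA _ => lebesgue4_worm_flat mA) (fun p => f p.1 * g p.2)).
  exact: (@sqint_prod _ _ _ _ _ lam2 lam2).
exact: CmeasurableX.
Qed.

End WormFlattening.

(** * The factor on the disc *)

Section DiscFactor.
Context {R : realType}.
Notation lam := (@lebesgue_measure R).
Notation RR := (measurableTypeR R).
Notation plane := (RR * RR)%type.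
Notation lam2 := (@lebesgue2 R).
Notation D1 := (@unit_disc1 R).
Implicit Types p : plane.

Lemma Cmeasurable_cexp d (T : measurableType d) (D : set T) (u v : T -> R) :
  measurable_fun D u -> measurable_fun D v ->
  Cmeasurable D (fun x => cexp (u x +i* v x)).
Proof.
move=> mu mv.
have me : measurable_fun D (fun x => expR (u x)) by exact: measurableT_comp.
have mc : measurable_fun D (fun x => cos (v x)).
  exact: (measurableT_comp (continuous_measurable_fun (@continuous_cos R))).
have ms : measurable_fun D (fun x => sin (v x)).
  exact: (measurableT_comp (continuous_measurable_fun (@continuous_sin R))).
split.
  by apply: eq_measurable_fun (measurable_funM me mc) => x _;
    rewrite -[RHS]/(complex.Re (cexp (u x +i* v x))) cexpE.
by apply: eq_measurable_fun (measurable_funM me ms) => x _;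
  rewrite -[RHS]/(complex.Im (cexp (u x +i* v x))) cexpE.
Qed.

Lemma eq_Cmeasurable d (T : measurableType d) (D : set T) (f g : T -> R[i]) :
  {in D, f =1 g} -> Cmeasurable D f -> Cmeasurable D g.
Proof.
by move=> fg [f1 f2]; split; [apply: eq_measurable_fun f1|apply: eq_measurable_fun f2];
  move=> x xD; rewrite /= fg.
Qed.

(** The principal power [w^(a + i b)]. *)
Definition disc_factor (a b : R) (w : R[i]) : R[i] := cexp ((a +i* b) * clog w).

Let rho (p : plane) : R := ln (sqdist p) / 2.
Let theta (p : plane) : R := carg (toC p).

Lemma disc_Re_gt0 p : D1 p -> 0 < complex.Re (toC p).
Proof. exact: Re_gt0_disc. Qed.

Lemma disc_clog p : D1 p -> clog (toC p) = rho p +i* theta p.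
Proof.
move=> /disc_Re_gt0 x0; rewrite /clog /rho -/(theta p) sqdistE; congr (_ +i* _).
have c0 : 0 < cabs (toC p) by rewrite cabs_gt0 Re_gt0_neq0.
by rewrite expr2 lnM ?posrE// -mulr2n -[X in X / _]mulr_natr mulfK.
Qed.

Lemma disc_factorE a b p : D1 p ->
  disc_factor a b (toC p) = cexp ((a * rho p - b * theta p) +i* (a * theta p + b * rho p)).
Proof.
by move=> Dp; rewrite /disc_factor disc_clog//; congr cexp; simpc.
Qed.

Lemma Cmeasurable_disc_factor a b : Cmeasurable D1 (disc_factor a b \o toC).
Proof.
have mr : measurable_fun D1 rho.
  by apply: measurable_funTS; apply: measurable_funM => //; exact: measurable_ln_sqdist.
have mt : measurable_fun D1 theta.
  (* [expR (- ln p.1)] stands for the inverse of [p.1], with which it agrees where [p.1 > 0]; it is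
     a composition of measurable functions. *)
  have m1 : measurable_fun D1 (fun p : plane => atan (p.2 * expR (- ln p.1))).
    apply: measurable_funTS.
    apply: (measurableT_comp (continuous_measurable_fun (@continuous_atan R))).
    apply: measurable_funM; first exact: measurable_snd.
    apply: measurableT_comp => //; apply: measurable_funN.
    by apply: measurableT_comp => //; exact: measurable_fst.
  apply: eq_measurable_fun m1 => p; rewrite inE => Dp.
  have x0 := disc_Re_gt0 Dp.
  by rewrite /theta carg_atan//= expRN lnK.
apply: (@eq_Cmeasurable _ _ _
   (fun p => cexp ((a * rho p - b * theta p) +i* (a * theta p + b * rho p)))).
  by move=> p; rewrite inE => Dp; rewrite /= disc_factorE.
apply: Cmeasurable_cexp.
  by apply: measurable_funB; apply: measurable_funM.
by apply: measurable_funD; apply: measurable_funM.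
Qed.

Lemma disc_sqdist p : D1 p -> 0 < sqdist p < 4.
Proof.
move=> Dp; have x0 := Re_gt0_neq0 (disc_Re_gt0 Dp).
rewrite sqdist_gt0 x0 /= sqdistE.
have : cabs (toC p) <= cabs (toC p - 1) + 1.
  rewrite -[X in _ + X](_ : cabs 1 = 1); last by rewrite cabs_real normr1.
  by rewrite -{1}(subrK 1 (toC p)) cabsD.
move: Dp; rewrite /unit_disc1 /= -/(toC p); have := cabs_ge0 (toC p); have := cabs_ge0 (toC p - 1).
set v := cabs (toC p - 1); set u := cabs (toC p) => v0 u0 v1 uv.
have v2 : v < 1 by rewrite -(expr1n _ 2) ltr_pXn2r ?nnegrE in v1.
have u2 : u < 2 by lra.
have : 0 <= (2 - u) * u by rewrite mulr_ge0// subr_ge0 ltW.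
by rewrite expr2; nra.
Qed.

Let cabs2E a b p : D1 p ->
  cabs (disc_factor a b (toC p)) ^+ 2 = expR (- (2 * b * theta p)) * expR (a * ln (sqdist p)).
Proof.
move=> Dp; rewrite disc_factorE// cabs_cexp /= expr2 -!expRD; congr expR.
by rewrite /rho; field.
Qed.

Let theta_bound b p : D1 p -> `|2 * b * theta p| <= `|b| * pi.
Proof.
move=> Dp; rewrite normrM.
have := carg_bound (disc_Re_gt0 Dp); rewrite -/(theta p) normrM (ger0_norm (ler0n _ 2)).
have := normr_ge0 b; set u := `|b|; set v := `|theta p|.
by have := normr_ge0 (theta p); rewrite -/v; nra.
Qed.

(** The squared modulus is [e^{-2 b theta} |w|^(2 a)], and [|theta| < pi / 2] bounds the first
    factor by a constant. The second is radial, so the domain may be enlarged to a punctured disc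
    centred at [0], where [a > -1] gives integrability. *)
Lemma sqint_disc_lty a b : -1 < a -> (sqint lam2 D1 (disc_factor a b \o toC) < +oo)%E.
Proof.
move=> a1.
have mD := @measurable_unit_disc1 R.
have mS : measurable (sqdist @^-1` `]0, 4[ : set plane).
  by apply: measurable_sqdist_preimage; exact: measurable_itv.
have mE : measurable_fun (sqdist @^-1` `]0, 4[ : set plane)
    (fun p => (expR (a * ln (sqdist p)))%:E).
  apply/measurable_EFinP; apply: measurableT_comp => //.
  by apply: measurable_funM => //; apply: measurable_funTS; exact: measurable_ln_sqdist.
have DS : D1 `<=` sqdist @^-1` `]0, 4[.
  by move=> p Dp; rewrite /= in_itv /=; exact: (disc_sqdist Dp).
have mED : measurable_fun D1 (fun p => (expR (a * ln (sqdist p)))%:E).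
  by apply: measurable_funS mE.
apply: (@le_lt_trans _ _ ((expR (`|b| * pi))%:E *
   \int[lam2]_(p in D1) (expR (a * ln (sqdist p)))%:E)%E).
  rewrite -ge0_integralZl//.
  apply: ge0_le_integral => //.
  - by move=> p _; rewrite lee_fin sqr_ge0.
  - by apply: Cmeasurable_cabs2; exact: Cmeasurable_disc_factor.
  - exact: measurable_funeM.
  move=> p Dp; rewrite lee_fin [leLHS]cabs2E// ler_wpM2r ?expR_ge0//.
  by rewrite ler_expR; have := theta_bound b Dp; rewrite ler_norml; lra.
apply: lte_mul_pinfty => //.
apply: (@le_lt_trans _ _ (\int[lam2]_(p in sqdist @^-1` `]0%R, 4%R[) (expR (a * ln (sqdist p)))%:E)%E).
  by apply: ge0_subset_integral.
exact: integral_disc_powR.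
Qed.

Lemma L2_disc_factor a b : -1 < a -> L2 lam2 D1 (disc_factor a b \o toC).
Proof. by move=> a1; split; [exact: Cmeasurable_disc_factor|exact: sqint_disc_lty]. Qed.

(** On the rectangle [K] one has [1 <= |w|^2 < 4], so neither factor of the squared modulus falls
    below a positive constant; [K] has positive measure. *)
Lemma sqint_disc_gt0 a b : (0 < sqint lam2 D1 (disc_factor a b \o toC))%E.
Proof.
have mD := @measurable_unit_disc1 R.
have mI1 : measurable (`[1, 3/2]%classic : set RR) by exact: measurable_itv.
have mI2 : measurable (`[0, 1/2]%classic : set RR) by exact: measurable_itv.
pose K : set plane := `[1, 3/2]%classic `*` `[0, 1/2]%classic.
have mK : measurable K by exact: measurableX.
have KD : K `<=` D1.
  move=> [x y] [/=]; rewrite !in_itv /= => /andP[? ?] /andP[? ?].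
  rewrite /unit_disc1 /= /toC /= (_ : (x +i* y) - 1 = (x - 1) +i* y); last by simpc.
  by rewrite cabs_sqr /=; nra.
pose M : R := `|a| * ln 4 + `|b| * pi.
have le1 p : K p -> expR (- M) <= cabs (disc_factor a b (toC p)) ^+ 2.
  move=> Kp; have Dp := KD _ Kp; rewrite cabs2E// -expRD ler_expR.
  have /andP[q0 q4] := disc_sqdist Dp.
  have q1 : 1 <= sqdist p.
    case: p Kp {Dp q0 q4} => x y [/=]; rewrite !in_itv /= => /andP[? ?] /andP[? ?].
    by rewrite /sqdist /=; nra.
  have l0 : 0 <= ln (sqdist p) by exact: ln_ge0.
  have l4 : ln (sqdist p) <= ln 4 by rewrite ler_ln ?posrE// ltW.
  have := theta_bound b Dp; rewrite ler_norml => /andP[t1 t2].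
  have : `|a * ln (sqdist p)| <= `|a| * ln 4.
    by rewrite normrM (ger0_norm l0) ler_wpM2l.
  rewrite ler_norml => /andP[a1 a2].
  by rewrite /M; lra.
apply: (@lt_le_trans _ _ (\int[lam2]_(p in K) (expR (- M))%:E)%E).
  have K0 : (0 < lam2 K)%E.
    rewrite lebesgue2_rect// !lebesgue_measure_itv /= !lte_fin.
    have -> : (1 < 3 / 2 :> R) by lra.
    have -> : (0 < 1 / 2 :> R) by lra.
    by rewrite -!EFinB -!EFinM lte_fin; lra.
  by rewrite integral_cst// mule_gt0// lte_fin expR_gt0.
apply: (@le_trans _ _ (sqint lam2 K (disc_factor a b \o toC))).
  apply: ge0_le_integral => //.
  by apply: measurable_funS (Cmeasurable_cabs2 (Cmeasurable_disc_factor a b)).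
apply: ge0_subset_integral => //.
  by apply: Cmeasurable_cabs2; exact: Cmeasurable_disc_factor.
by move=> p _; rewrite lee_fin sqr_ge0.
Qed.

End DiscFactor.

(** * The factor on the annulus *)

Section AnnulusFactor.
Context {R : realType}.
Notation RR := (measurableTypeR R).
Notation plane := (RR * RR)%type.
Notation lam2 := (@lebesgue2 R).
Notation alpha := (@disc_area R).
Implicit Types (p : plane) (w : R[i]) (j : int) (mu : R).

Lemma cJM (z w : R[i]) : Num.conj (z * w) = Num.conj z * Num.conj w.
Proof. exact: rmorphM. Qed.

Lemma cexpJ (z : R[i]) : Num.conj (cexp z) = cexp z^*.
Proof. exact: cexp_conj. Qed.

Lemma cexpXz (z : R[i]) (j : int) : cexp z ^ j = cexp (z *~ j).
Proof.
have H n : cexp z ^+ n = cexp (z *+ n).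
  by elim: n => [|n IH]; rewrite ?expr0 ?mulr0n ?cexp0// exprS IH mulrS cexpD.
case: j => n; first exact: H.
by rewrite NegzE -exprnN mulrNz cexpN -H.
Qed.

Lemma imag_mulrz (x : R) (n : int) : (0 +i* x) *~ n = 0 +i* (x *~ n).
Proof.
have H m : (0 +i* x) *+ m = 0 +i* (x *+ m).
  by elim: m => [|m IH]; rewrite ?mulr0n// !mulrS IH; simpc.
by case: n => m; rewrite ?NegzE ?mulrNz -?pmulrn H//; simpc.
Qed.

Lemma expRXz (x : R) j : expR x ^ j = expR (j%:~R * x).
Proof.
have H n : expR x ^+ n = expR (n%:R * x) by rewrite -expRM_natl.
case: j => n; first exact: H.
by rewrite NegzE -exprnN H rmorphN mulNr expRN.
Qed.

Lemma cabsXz w j : cabs (w ^ j) = cabs w ^ j.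
Proof.
have H n : cabs (w ^+ n) = cabs w ^+ n.
  by elim: n => [|n IH]; rewrite ?expr0 ?cabs_real ?normr1// !exprS cabsM IH.
by case: j => n; rewrite ?NegzE -?exprnN ?cabsV H.
Qed.

Lemma expR_log_sq w : w != 0 -> expR (log_sq w) = cabs w ^+ 2.
Proof. by move=> w0; rewrite lnK// posrE exprn_gt0// cabs_gt0. Qed.

Lemma cabs2Xz w j : w != 0 -> cabs (w ^ j) ^+ 2 = expR (j%:~R * log_sq w).
Proof.
move=> w0; rewrite cabsXz -expRXz expR_log_sq//.
by rewrite (exprnP _ 2) (exprnP (cabs w) 2) !exprz_exp mulrC.
Qed.

(** Since [- b + i a = i (a + i b)], the exponential is what the summand [i log |z_2|^2] of [L]
    contributes to [E_{a + i b}]. *)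
Definition annulus_factor (b a : R) j w : R[i] :=
  cexp ((- b +i* a) * (log_sq w)%:C) * w ^ j.

Lemma annulus_factorE b a j w :
  annulus_factor b a j w = cexp ((- b * log_sq w) +i* (a * log_sq w)) * w ^ j.
Proof. by rewrite /annulus_factor; congr (cexp _ * _); simpc. Qed.

Lemma annulus_neq0 mu p : annulus mu p -> toC p != 0.
Proof. by move/annulusE => []. Qed.

(** With [s = log |w|^2], the choice of [b] gives [e^{-2 b s} |w|^(2 j) = e^{-(j + 1) s + j s} =
    e^{-s}], so [j] disappears. *)
Lemma annulus_factor_mul (j : int) (a a' : R) w : w != 0 ->
  let b := (j + 1)%:~R / 2 in
  annulus_factor b a j w * (annulus_factor b a' j w)^* =
  (expR (- log_sq w))%:C * cexp (0 +i* ((a - a') * log_sq w)).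
Proof.
move=> w0 b; rewrite !annulus_factorE cJM cexpJ mulrACA -cexpD.
rewrite -sqr_normc norm_cabs -rmorphXn /= cabs2Xz//.
have e (x : R) : (expR x)%:C = cexp x%:C by rewrite cexpE /= cos0 sin0 mulr1 mulr0.
rewrite !e -!cexpD; congr cexp; simpc; congr (_ +i* _); last by ring.
by rewrite /b rmorphD /=; field.
Qed.

Lemma annulus_factor_rot b a j c w : cabs c = 1 ->
  annulus_factor b a j (c * w) = c ^ j * annulus_factor b a j w.
Proof.
move=> c1; rewrite /annulus_factor /log_sq cabsM c1 mul1r.
by rewrite expfzMl mulrCA.
Qed.

(* Negative powers are written [w^-n = (w^n)^* e^{-n log |w|^2}]. *)
Lemma Cmeasurable_toC_Xz mu j : Cmeasurable (annulus mu) (fun p => toC p ^ j).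
Proof.
have mX n : Cmeasurable (annulus mu) (fun p => toC p ^+ n).
  elim: n => [|n IH]; first exact: Cmeasurable_cst.
  under eq_fun do rewrite exprS.
  apply: CmeasurableM => //; split.
    by apply: measurable_funTS; exact: measurable_fst.
  by apply: measurable_funTS; exact: measurable_snd.
case: j => n; first exact: mX.
pose g p : R[i] := (toC p ^+ n.+1)^* * cexp ((- (n.+1%:R * ln (sqdist p))) +i* 0).
apply: (@eq_Cmeasurable _ _ _ _ g).
  move=> p; rewrite inE => /annulus_neq0 p0; rewrite NegzE -exprnN /g.
  have X0 : toC p ^+ n.+1 != 0 by rewrite expf_neq0.
  apply: (mulfI X0); rewrite divff// mulrA -sqr_normc norm_cabs -rmorphXn /=.
  have := @cabs2Xz (toC p) n.+1 p0; rewrite -exprnP => ->.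
  rewrite log_sq_toC cexpE /= cos0 sin0 mulr1 mulr0 -rmorphM /= -expRD.
  by rewrite subrr expR0.
apply: CmeasurableM; first by apply: CmeasurableJ; exact: mX.
apply: Cmeasurable_cexp; last exact: measurable_cst.
apply: measurable_funN; apply: measurable_funM => //.
by apply: measurable_funTS; exact: measurable_ln_sqdist.
Qed.

Lemma Cmeasurable_annulus_factor mu b a j :
  Cmeasurable (annulus mu) (annulus_factor b a j \o toC).
Proof.
apply: (@eq_Cmeasurable _ _ _ _ (fun p =>
   cexp ((- b * ln (sqdist p)) +i* (a * ln (sqdist p))) * toC p ^ j)).
  by move=> p _; rewrite /= annulus_factorE log_sq_toC.
apply: CmeasurableM; last exact: Cmeasurable_toC_Xz.
by apply: Cmeasurable_cexp; apply: measurable_funM => //;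
  apply: measurable_funTS; exact: measurable_ln_sqdist.
Qed.

Lemma annulus_expRN mu p : annulus mu p -> expR (- log_sq (toC p)) = (sqdist p)^-1.
Proof. by move=> Ap; rewrite expRN expR_log_sq ?(annulus_neq0 Ap)// sqdistE. Qed.

Lemma sqint_annulus mu j a : 0 < mu ->
  sqint lam2 (annulus mu) (annulus_factor ((j + 1)%:~R / 2) a j \o toC) =
  (alpha * (2 * mu))%:E.
Proof.
move=> mu0; rewrite -integral_annulus_inv//; apply: eq_integral => p.
rewrite inE => Ap; congr EFin; rewrite -(annulus_expRN Ap) /=.
have p0 := annulus_neq0 Ap.
rewrite annulus_factorE cabsM cabs_cexp /= exprMn cabs2Xz// expr2 -!expRD.
by congr expR; rewrite rmorphD /=; field.
Qed.

Lemma L2_annulus_factor mu j a : 0 < mu ->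
  L2 lam2 (annulus mu) (annulus_factor ((j + 1)%:~R / 2) a j \o toC).
Proof.
by move=> mu0; split; [exact: Cmeasurable_annulus_factor|rewrite sqint_annulus// ltry].
Qed.

Lemma Cint_annulus_eq mu j a a' : 0 < mu ->
  Cint lam2 (annulus mu) (fun p => annulus_factor ((j + 1)%:~R / 2) a j (toC p) *
    (annulus_factor ((j + 1)%:~R / 2) a' j (toC p))^*) =
  (alpha * (if a - a' == 0 then 2 * mu else 2 * sin ((a - a') * mu) / (a - a')))%:C.
Proof.
move=> mu0; rewrite -Cint_annulus//; apply: eq_Cint => p; rewrite inE => Ap.
by rewrite annulus_factor_mul ?(annulus_neq0 Ap)// (annulus_expRN Ap) log_sq_toC.
Qed.

Lemma annulus_rot mu c : cabs c = 1 -> plane_mul c @^-1` annulus mu = annulus mu.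
Proof.
by move=> c1; apply/seteqP; split => p; rewrite /annulus /= sqdist_mul c1 expr1n mul1r.
Qed.

(* Rotating [w] by [c = exp (i pi / (j - j'))] multiplies the integrand by
   [c ^ (j - j') = -1]. *)
Lemma Cint_annulus_neq mu b b' a a' j j' : j != j' ->
  Cintegrable lam2 (annulus mu) (fun p => annulus_factor b a j (toC p) *
    (annulus_factor b' a' j' (toC p))^*) ->
  Cint lam2 (annulus mu) (fun p => annulus_factor b a j (toC p) *
    (annulus_factor b' a' j' (toC p))^*) = 0.
Proof.
move=> jj'; set h := (fun p => _) => hi.
have n0 : (j - j')%:~R != 0 :> R by rewrite intr_eq0 subr_eq0.
pose c : R[i] := cexp (0 +i* (pi / (j - j')%:~R)).
have c1 : cabs c = 1 by exact: cabs_cexp_i.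
have c0 : c != 0 by exact: cexp_neq0.
have hc p : h (plane_mul c p) = - h p.
  rewrite /h !toC_mul !annulus_factor_rot// cJM mulrACA.
  have -> : c ^ j * (c ^ j')^* = -1.
    have -> : Num.conj (c ^ j') = c ^ (- j').
      rewrite [LHS](_ : _ = (c ^ j')^-1); last first.
        by rewrite invc_norm norm_cabs cabsXz c1 exp1rz expr1n invr1 mul1r.
      by rewrite invr_expz.
    rewrite -expfzDr// cexpXz [_ *~ _](_ : _ = 0 +i* pi); last first.
      by rewrite imag_mulrz -mulrzr divfK.
    by rewrite cexpE /= expR0 cospi sinpi !mul1r; apply: complex_ext; rewrite /= ?oppr0.
  by rewrite mulN1r.
have mh := Cintegrable_measurable hi.
have mA := measurable_annulus mu.
have H : forall A, measurable A -> A `<=` annulus mu -> lam2 (plane_mul c @^-1` A) = lam2 A.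
  by move=> A mAA _; rewrite -[RHS](lebesgue2_plane_mul c0 mAA) c1 expr1n mul1e.
have e1 := Cint_transfer (measurable_plane_mul c) mA H mh.
rewrite (annulus_rot mu c1) in e1.
have e2 : Cint lam2 (annulus mu) (fun p => h (plane_mul c p)) = - Cint lam2 (annulus mu) h.
  rewrite -mulN1r -(CintZ mA (-1) hi); apply: eq_Cint => p _.
  by rewrite hc mulN1r.
have : Cint lam2 (annulus mu) h + Cint lam2 (annulus mu) h = 0.
  by rewrite -{1}e1 e2 addNr.
by move/eqP; rewrite -mulr2n mulrn_eq0 /= => /eqP.
Qed.

End AnnulusFactor.

(** * Norms and inner products on the worm domain *)

Section WormFunctions.
Context {R : realType}.
Notation RR := (measurableTypeR R).
Notation plane := (RR * RR)%type.
Notation lam2 := (@lebesgue2 R).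
Notation alpha := (@disc_area R).
Notation D1 := (@unit_disc1 R).
Implicit Types (j : int) (mu a c : R) (z : C2 R).

Lemma mulJ_cabs (w : R[i]) : w * Num.conj w = (cabs w ^+ 2)%:C.
Proof. by have /esym := sqr_normc w; rewrite norm_cabs -rmorphXn. Qed.

Definition half_succ j : R := (j + 1)%:~R / 2.

(* The case [a1 = a2] is [E_{a + i (j + 1) / 2} z_2^j]; other choices multiply
   it by the unimodular factor [e^{i (a2 - a1) log |z_2|^2}]. *)
Definition wormT (a1 a2 : R) j z : R[i]^o :=
  disc_factor a1 (half_succ j) (worm_zeta z) * annulus_factor (half_succ j) a2 j z.2.

Lemma wormHE c0 nu l j : wormH c0 nu l j = wormT (c0 + nu * l%:R) (c0 + nu * l%:R) j.
Proof.
apply/funext => z; rewrite /wormH /wormT /wormE /wormL mulrDr cexpD -mulrA.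
congr (_ * (cexp _ * _)); rewrite /half_succ.
by apply: complex_ext; rewrite !(cReM, cImM) /=; ring.
Qed.

Definition worm4 mu : set (plane * plane) := real_to_C2 @^-1` worm mu.

Lemma measurable_worm4 mu : measurable (worm4 mu).
Proof.
rewrite /worm4 worm_preimage -[X in measurable X]setTI.
apply: measurable_worm_flat => //.
by apply: measurableX; [exact: measurable_unit_disc1|exact: measurable_annulus].
Qed.

Lemma wormT_flat a1 a2 j (p : plane * plane) : wormT a1 a2 j (real_to_C2 p) =
  (disc_factor a1 (half_succ j) \o toC) (worm_flat p).1 *
  (annulus_factor (half_succ j) a2 j \o toC) (worm_flat p).2.
Proof. by rewrite /wormT worm_zeta_flat. Qed.

Definition disc_norm a j : R :=
  fine (sqint lam2 D1 (disc_factor a (half_succ j) \o toC)).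

Lemma disc_normE a j : -1 < a ->
  sqint lam2 D1 (disc_factor a (half_succ j) \o toC) = (disc_norm a j)%:E.
Proof. by move=> a1; rewrite /disc_norm -sqint_fineK// sqint_disc_lty. Qed.

Lemma disc_norm_gt0 a j : -1 < a -> 0 < disc_norm a j.
Proof. by move=> a1; rewrite -lte_fin -disc_normE// sqint_disc_gt0. Qed.

Lemma sqint_wormT mu a1 a2 j : 0 < mu -> -1 < a1 ->
  sqint lebesgue4 (worm4 mu) (wormT a1 a2 j \o real_to_C2) =
  (disc_norm a1 j * (alpha * (2 * mu)))%:E.
Proof.
move=> mu0 a10.
rewrite EFinM -disc_normE// -(sqint_annulus j a2 mu0) -sqint_worm.
- by apply: eq_integral => p _; rewrite /= wormT_flat.
- exact: Cmeasurable_disc_factor.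
- exact: Cmeasurable_annulus_factor.
Qed.

Lemma L2_wormT mu a1 a2 j : 0 < mu -> -1 < a1 ->
  L2 lebesgue4 (worm4 mu) (wormT a1 a2 j \o real_to_C2).
Proof.
move=> mu0 a10; split; last by rewrite sqint_wormT// ltry.
rewrite (_ : _ \o _ = (fun p => (disc_factor a1 (half_succ j) \o toC) (worm_flat p).1 *
  (annulus_factor (half_succ j) a2 j \o toC) (worm_flat p).2)).
  by apply: Cmeasurable_worm; [exact: Cmeasurable_disc_factor|exact: Cmeasurable_annulus_factor].
by apply/funext => p; rewrite /= wormT_flat.
Qed.

Definition disc_inner a a' j : R[i] :=
  Cint lam2 D1 (fun p => disc_factor a (half_succ j) (toC p) *
    (disc_factor a' (half_succ j) (toC p))^*).

(** For positive [mu], the integral of [e^{i w s}] over []-mu, mu[]. *)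
Definition sinc_int mu w : R := if w == 0 then 2 * mu else 2 * sin (w * mu) / w.

Lemma disc_inner_le a a' j : -1 < a -> -1 < a' ->
  cabs (disc_inner a a' j) ^+ 2 <= disc_norm a j * disc_norm a' j.
Proof.
move=> a1 a1'; apply: (Cauchy_Schwarz (@measurable_unit_disc1 R)
  (L2_disc_factor _ a1) (L2_disc_factor _ a1')).
Qed.

Lemma disc_inner_diag a j : disc_inner a a j = (disc_norm a j)%:C.
Proof.
rewrite /disc_inner (@eq_Cint _ _ _ _ _ _
  (fun p => (cabs (disc_factor a (half_succ j) (toC p)) ^+ 2)%:C)); last first.
  by move=> p _; rewrite mulJ_cabs.
apply: complex_ext; first by [].
by rewrite /= /Rintegral integral0_eq.
Qed.

Let innerT_flat mu a1 a2 a1' a2' j j' :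
  0 < mu -> -1 < a1 -> -1 < a1' ->
  innerL2 (worm mu) (wormT a1 a2 j) (wormT a1' a2' j') =
  Cint lam2 D1 (fun p => disc_factor a1 (half_succ j) (toC p) *
    (disc_factor a1' (half_succ j') (toC p))^*) *
  Cint lam2 (annulus mu) (fun p => annulus_factor (half_succ j) a2 j (toC p) *
    (annulus_factor (half_succ j') a2' j' (toC p))^*).
Proof.
move=> mu0 h1 h1'.
have i1 := CintegrableMJ (@measurable_unit_disc1 R)
  (L2_disc_factor (half_succ j) h1) (L2_disc_factor (half_succ j') h1').
have i2 := CintegrableMJ (measurable_annulus mu)
  (L2_annulus_factor j a2 mu0) (L2_annulus_factor j' a2' mu0).
rewrite -(Cint_worm i1 i2); apply: eq_Cint => p _.
by rewrite !wormT_flat cJM mulrACA.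
Qed.

Lemma innerT_neq mu a1 a2 a1' a2' j j' : 0 < mu -> -1 < a1 -> -1 < a1' -> j != j' ->
  innerL2 (worm mu) (wormT a1 a2 j) (wormT a1' a2' j') = 0.
Proof.
move=> mu0 h1 h1' jj'; rewrite innerT_flat// Cint_annulus_neq ?mulr0//.
exact: (CintegrableMJ (measurable_annulus mu)
  (L2_annulus_factor j a2 mu0) (L2_annulus_factor j' a2' mu0)).
Qed.

Lemma innerT_eq mu a1 a2 a1' a2' j : 0 < mu -> -1 < a1 -> -1 < a1' ->
  innerL2 (worm mu) (wormT a1 a2 j) (wormT a1' a2' j) =
  disc_inner a1 a1' j * (alpha * sinc_int mu (a2 - a2'))%:C.
Proof. by move=> mu0 h1 h1'; rewrite innerT_flat// Cint_annulus_eq. Qed.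

End WormFunctions.

(** * Sum of the inverse squares of odd integers *)

Section OddSquares.
Context {R : realType}.
Implicit Types (n m k P : nat) (x : R).

Lemma sin_le_id x : 0 <= x -> sin x <= x.
Proof.
by move=> x0; rewrite (le_trans (ler_norm _))// (le_trans (norm_sin_le x))// ger0_norm.
Qed.

Lemma csc2_double x : 0 < sin x -> 0 < cos x ->
  4 * (sin (x *+ 2)) ^- 2 = (sin x) ^- 2 + (cos x) ^- 2.
Proof.
move=> s0 c0; have := cos2Dsin2 x; rewrite sin_mulr2n.
set s := sin x in s0 *; set c := cos x in c0 * => e.
have -> : (s ^- 2 + c ^- 2) = (c ^+ 2 + s ^+ 2) / (c * s) ^+ 2.
  by field; rewrite !gt_eqF.
by rewrite e; field; rewrite !gt_eqF.
Qed.

(* The doubling formula [csc2_double] turns the sum of [1 / sin^2] over the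
   nodes of level [m] into a quarter of the sum over the nodes of level [m + 1]. *)
Definition csc_node m k : R := (2 * k + 1)%:R * pi / 2 ^+ m.+2.

Lemma csc_node_itv m k : (k < 2 ^ m)%N -> 0 < csc_node m k < pi / 2.
Proof.
move=> km; have p0 := @pi_gt0 R.
have q0 : 0 < 2 ^+ m.+2 :> R by rewrite exprn_gt0.
apply/andP; split; first by rewrite /csc_node !mulr_gt0 ?invr_gt0// ltr0n addn1.
have e : pi / 2 * 2 ^+ m.+2 = pi * (2 ^ m.+1)%:R :> R by rewrite natrX [in LHS]exprS; field.
rewrite /csc_node ltr_pdivrMr// e mulrC ltr_pM2l// ltr_nat expnS; lia.
Qed.

Lemma sum_csc2 m : \sum_(k < 2 ^ m) (sin (csc_node m k)) ^- 2 = 2 * 4 ^+ m :> R.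
Proof.
elim: m => [|m IH].
  rewrite expn0 big_ord1 expr0 mulr1 /csc_node muln0 add0n mul1r.
  have s4 : sin (pi / 2 ^+ 2) ^+ 2 = 1 / 2 :> R.
    have := @cos_mulr2n R (pi / 2 ^+ 2).
    have -> : (pi / 2 ^+ 2) *+ 2 = pi / 2 :> R by rewrite -mulr_natr expr2; field.
    by rewrite cos_pihalf cos2sin2; lra.
  by rewrite s4; field.
have e : (2 ^ m.+1 = 2 ^ m + 2 ^ m)%N by rewrite expnS mul2n addnn.
rewrite e big_split_ord /=.
(* Reversing the second half pairs the node [x] of index [k] with the node [pi / 2 - x], whose sine
   is [cos x]. *)
rewrite [X in _ + X](reindex_inj rev_ord_inj) /= -big_split /=.
rewrite exprS mulrCA -IH mulr_sumr; apply: eq_bigr => k _.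
have dbl : csc_node m k = csc_node m.+1 k *+ 2.
  by rewrite /csc_node [in RHS]exprS -mulr_natr; field; rewrite expf_neq0.
have km : (k < 2 ^ m.+1)%N by rewrite (leq_trans (ltn_ord k))// e leq_addr.
have /andP[x0 x1] := csc_node_itv km.
have p0 := @pi_gt0 R.
have s0 : 0 < sin (csc_node m.+1 k) by rewrite sin_gt0_pihalf ?x0.
have c0 : 0 < cos (csc_node m.+1 k) by rewrite cos_gt0_pihalf// x1 andbT; lra.
rewrite dbl csc2_double//; congr (_ + _ ^- 2).
rewrite -[in RHS](opprK (csc_node _ _)) cosN -sinDpihalf; congr sin.
rewrite /csc_node.
have -> : (2 * (2 ^ m + (2 ^ m - k.+1)) + 1 = 2 ^ m.+2 - (2 * k + 1))%N.
  by have := ltn_ord k; rewrite !expnS; lia.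
rewrite natrB; last by have := ltn_ord k; rewrite !expnS; lia.
by rewrite natrX [2 ^+ m.+3]exprS; field; rewrite expf_neq0.
Qed.

(** The nodes of level [n] are [2 k + 1] times [pi / 2^(n+2)]. By [sin x <= x] the first [2^n] terms
    sum to at most [(pi / 2^(n+2))^2] times [2 * 4^n], which is [pi^2 / 8] whatever [n]. *)
Lemma sum_odd_inv2_le n : \sum_(0 <= k < n) ((2 * k + 1)%:R ^- 2) <= pi ^+ 2 / 8 :> R.
Proof.
have p0 := @pi_gt0 R.
have n2 : (n <= 2 ^ n)%N by exact/ltnW/ltn_expl.
apply: (@le_trans _ _ (\sum_(0 <= k < 2 ^ n) ((2 * k + 1)%:R ^- 2))).
  by rewrite [leRHS](big_cat_nat _ n2)//= lerDl sumr_ge0.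
have q0 : 0 < 2 ^+ n.+2 :> R by rewrite exprn_gt0.
have := sum_csc2 n; rewrite big_mkord => S.
have : \sum_(k < 2 ^ n) ((2 * k + 1)%:R ^- 2) <=
    \sum_(k < 2 ^ n) ((pi / 2 ^+ n.+2) ^+ 2 * (sin (csc_node n k)) ^- 2).
  apply: ler_sum => k _; have /andP[x0 x1] := csc_node_itv (ltn_ord k).
  have s0 : 0 < sin (csc_node n k) by rewrite sin_gt0_pihalf ?x0.
  have s1 : sin (csc_node n k) <= csc_node n k by rewrite sin_le_id// ltW.
  have o0 : 0 < (2 * k + 1)%:R :> R by rewrite ltr0n addn1.
  rewrite -ler_pdivrMl ?exprn_gt0 ?divr_gt0//.
  have -> : (pi / 2 ^+ n.+2) ^- 2 / (2 * k + 1)%:R ^+ 2 = (csc_node n k) ^- 2.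
    have gen (a Q O : R) : a != 0 -> Q != 0 -> O != 0 ->
        (a / Q) ^- 2 / O ^+ 2 = (O * a / Q) ^- 2.
      by move=> a0 Q0 O0; field; rewrite a0 Q0 O0.
    by apply: gen; rewrite gt_eqF.
  rewrite lef_pV2 ?posrE ?exprn_gt0//.
  by rewrite ler_pXn2r// nnegrE ltW.
move=> /le_trans; apply; rewrite -mulr_sumr S.
have -> : (4 : R) ^+ n = 2 ^+ n * 2 ^+ n by rewrite -exprMn; congr (_ ^+ _); ring.
have gen (a Q : R) : Q != 0 -> (a / (2 * (2 * Q))) ^+ 2 * (2 * (Q * Q)) = a ^+ 2 / 8.
  by move=> Q0; field.
have q1 : 2 ^+ n != 0 :> R by rewrite expf_neq0.
by rewrite !(exprS 2 n.+1, exprS 2 n) gen.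
Qed.

(** As [k] grows, [2 P - 1 - 2 k] runs through the [P] positive odd numbers below [2 P], then
    through the negative ones. Each sign contributes at most [1 / 2]; on the positive side the bound
    still holds with the absent term of [2 P + 1] included, and this term is the gap. *)
Lemma sum_odd_sqr_shift P n :
  \sum_(0 <= k < n) (4 / (pi ^+ 2 * ((2 * P%:R - 1) - 2 * k%:R) ^+ 2)) <=
  1 - 4 / (pi ^+ 2 * (2 * P + 1)%:R ^+ 2) :> R.
Proof.
have p0 := @pi_gt0 R.
have p2 : 0 < pi ^+ 2 :> R by rewrite exprn_gt0.
pose q k : R := 4 / (pi ^+ 2 * ((2 * P%:R - 1) - 2 * k%:R) ^+ 2).
have q0 k : 0 <= q k by rewrite divr_ge0// mulr_ge0 ?sqr_ge0// ltW.
pose t i : R := (2 * i + 1)%:R ^- 2.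
apply: (@le_trans _ _ (\sum_(0 <= k < P + n) q k)).
  rewrite [leRHS](@big_cat_nat _ _ _ n)//=; last exact: leq_addl.
  by rewrite lerDl sumr_ge0.
rewrite (@big_cat_nat _ _ _ P)//=; last exact: leq_addr.
have e1 : \sum_(0 <= k < P) q k = 4 / pi ^+ 2 * \sum_(0 <= k < P) t k.
  rewrite mulr_sumr !big_mkord (reindex_inj rev_ord_inj) /=; apply: eq_bigr => i _.
  rewrite /q /t natrB// -natr1 invfM mulrA; congr (_ * _ ^- 2).
  by rewrite natrD natrM; ring.
have e2 : \sum_(P <= k < P + n) q k = 4 / pi ^+ 2 * \sum_(0 <= k < n) t k.
  rewrite -{1}(add0n P) (addnC P n) big_addn addnK mulr_sumr; apply: eq_bigr => i _.
  rewrite /q /t natrD invfM mulrA; congr (_ * _^-1).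
  by rewrite natrD natrM; ring.
have h1 := sum_odd_inv2_le P.+1; have h2 := sum_odd_inv2_le n.
rewrite big_nat_recr//= in h1.
have c0 : 0 < 4 / pi ^+ 2 :> R by rewrite divr_gt0.
have e3 : 4 / (pi ^+ 2 * (2 * P + 1)%:R ^+ 2) = 4 / pi ^+ 2 * (2 * P + 1)%:R ^- 2 :> R.
  by rewrite invfM mulrA.
rewrite e1 e2 e3.
have e4 : 4 / pi ^+ 2 * (pi ^+ 2 / 8) = 1 / 2 :> R.
  by rewrite mulrA mulfVK ?gt_eqF//; lra.
have := ler_wpM2l (ltW c0) h1; have := ler_wpM2l (ltW c0) h2.
rewrite e4 mulrDr; rewrite -/t; lra.
Qed.

End OddSquares.

(** * Bessel inequality and incompleteness *)

Section Incompleteness.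
Context {R : realType}.
Notation RR := (measurableTypeR R).
Implicit Types (D : set (C2 R)) (f g w : C2 R -> R[i]^o).

(** Pairing with [w] is a bounded functional that vanishes on the span of [S] but not at [f], which
    keeps [f] at a positive distance from the span. As [w] is merely square integrable, it may be
    nonholomorphic. *)
Lemma not_bergman_complete D (S : set (C2 R -> R[i]^o)) f w :
  let D4 : set ((RR * RR) * (RR * RR))%type := real_to_C2 @^-1` D in
  measurable D4 -> bergman D f ->
  L2 lebesgue4 D4 (f \o real_to_C2) -> L2 lebesgue4 D4 (w \o real_to_C2) ->
  innerL2 D f w != 0 ->
  (forall g, S g -> L2 lebesgue4 D4 (g \o real_to_C2) /\ innerL2 D g w = 0) ->
  ~ bergman_complete D S.
Proof.
move=> D4 mD bf lf lw fw0 HS cpl.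
pose good (g : C2 R -> R[i]) := L2 lebesgue4 D4 (g \o real_to_C2) /\ innerL2 D g w = 0.
have goodD g h : good g -> good h -> good (fun z => g z + h z).
  move=> [g1 g2] [h1 h2]; split; first exact: L2D.
  have := CintD mD (CintegrableMJ mD g1 lw) (CintegrableMJ mD h1 lw).
  rewrite [X in _ = X + _]g2 [X in _ = _ + X]h2 addr0 => <-.
  by apply: eq_Cint => p _; rewrite mulrDl.
have goodZ c g : good g -> good (fun z => c * g z).
  move=> [g1 g2]; split; first exact: L2Z.
  have := CintZ mD c (CintegrableMJ mD g1 lw).
  rewrite [X in _ = _ * X]g2 mulr0 => <-.
  by apply: eq_Cint => p _; rewrite mulrA.
have good_sum n (c : 'I_n -> R[i]) (g : 'I_n -> C2 R -> R[i]^o) :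
    (forall i, S (g i)) -> good (fun z => \sum_(i < n) c i * g i z).
  elim: n c g => [|n IH] c g Sg.
    have -> : (fun z : C2 R => \sum_(i < 0) c i * g i z) = (fun z => 0 * w z).
      by apply/funext => z; rewrite big_ord0 mul0r.
    split; first exact: L2Z.
    have := CintZ mD 0 (CintegrableMJ mD lw lw); rewrite mul0r => e.
    by apply: etrans e; apply: eq_Cint => p _; rewrite mulrA.
  have -> : (fun z : C2 R => \sum_(i < n.+1) c i * g i z) = (fun z =>
      \sum_(i < n) c (widen_ord (leqnSn n) i) * g (widen_ord (leqnSn n) i) z +
      c ord_max * g ord_max z).
    by apply/funext => z; rewrite big_ord_recr.
  apply: goodD; first by apply: IH => i.
  by apply: goodZ; exact: HS.
pose X := fine (sqint lebesgue4 D4 (w \o real_to_C2)).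
have X0 : 0 <= X by rewrite fine_ge0// sqint_ge0.
pose kap := cabs (innerL2 D f w).
have k0 : 0 < kap by rewrite cabs_gt0.
(* Approximation within this distance would give [kap^2 <= kap^2 X / (X + 1)^2], whereas
   [X < (X + 1)^2]; the choice avoids a square root of [X]. *)
have e0 : 0 < kap / (X + 1) by rewrite divr_gt0// ltr_wpDl.
have [g [n [c [h [Sh gE]]]] dist] := cpl f bf _ e0.
have [lg gw0] : good g.
  have -> : g = (fun z => \sum_(i < n) c i * h i z) by apply/funext => z; exact: gE.
  exact: good_sum.
have [lNg Ngw0] := goodZ (-1) g (conj lg gw0).
have lfg := L2D mD lf lNg.
have ifg : Cint lebesgue4 D4 (fun p => (f (real_to_C2 p) + -1 * g (real_to_C2 p)) *
    Num.conj (w (real_to_C2 p))) = innerL2 D f w.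
  have := CintD mD (CintegrableMJ mD lf lw) (CintegrableMJ mD lNg lw).
  rewrite [X in _ = _ + X]Ngw0 addr0 => e.
  by apply: etrans e; apply: eq_Cint => p _; rewrite mulrDl.
have CS := Cauchy_Schwarz mD lfg lw; rewrite [X in cabs X]ifg -/kap -/X in CS.
have d1 : fine (sqint lebesgue4 D4 (fun p => f (real_to_C2 p) + -1 * g (real_to_C2 p))) <
    (kap / (X + 1)) ^+ 2.
  rewrite -lte_fin -sqint_fineK; last exact: lfg.2.
  apply: le_lt_trans dist; rewrite le_eqVlt; apply/orP; left; apply/eqP.
  by apply: eq_integral => p _; rewrite mulN1r.
have {CS} : kap ^+ 2 <= (kap / (X + 1)) ^+ 2 * X.
  by apply: le_trans CS _; rewrite ler_wpM2r// ltW.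
have X1 : 0 < X + 1 by rewrite ltr_wpDl.
rewrite expr_div_n mulrAC ler_pdivlMr ?exprn_gt0// ler_pM2l ?exprn_gt0//.
by rewrite leNgt => /negP; apply; nra.
Qed.

End Incompleteness.

Section Worm.
Context {R : realType}.
Variables (mu c0 : R).
Hypotheses (hmu : pi / 2 < mu) (hc0 : -1 < c0).
Notation W := (worm mu).
Notation nu := (pi / (2 * mu)).
Notation H := (wormH c0 nu).
Notation alpha := (@disc_area R).

Let mu0 : 0 < mu.
Proof. by apply: le_lt_trans hmu; rewrite divr_ge0// pi_ge0. Qed.

Let nu0 : 0 < nu.
Proof. by rewrite divr_gt0// ?pi_gt0// mulr_gt0. Qed.

Let aN1 (l : nat) : -1 < c0 + nu * l%:R.
Proof. by apply: (lt_le_trans hc0); rewrite lerDl mulr_ge0// ltW. Qed.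

Let N (l : nat) (j : int) : R := disc_norm (c0 + nu * l%:R) j * (alpha * (2 * mu)).

Let N0 l j : 0 < N l j.
Proof. by rewrite /N !mulr_gt0// ?disc_norm_gt0// disc_area_gt0. Qed.

Lemma sqnormH l j : sqnormL2 W (H l j) = (N l j)%:E.
Proof. by rewrite wormHE; exact: sqint_wormT. Qed.

Lemma L2_wormH l j : L2 lebesgue4 (worm4 mu) (H l j \o real_to_C2).
Proof. by rewrite wormHE; exact: L2_wormT. Qed.

Lemma bergman_wormH l j : bergman W (H l j).
Proof. by split; [exact: wormH_holomorphic|rewrite sqnormH ltry]. Qed.

Lemma innerH_neq l l' j j' : j != j' -> innerL2 W (H l j) (H l' j') = 0.
Proof. by move=> jj'; rewrite !wormHE innerT_neq. Qed.

(** With [d = l - l'], the annulus integral [2 sin (nu d mu) / (nu d)] is [2 mu] times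
    [2 sin (pi d / 2) / (pi d)]. The sine is bounded by [1] and the disc integral by the
    Cauchy-Schwarz inequality. *)
Lemma innerH_le l l' j : l != l' ->
  cabs (innerL2 W (H l j) (H l' j)) ^+ 2 <=
  N l j * N l' j * (4 / (pi ^+ 2 * (l%:R - l'%:R) ^+ 2)).
Proof.
move=> ll'; rewrite !wormHE innerT_eq// cabsM cabs_real exprMn real_normK ?num_real//.
have d0 : l%:R - l'%:R != 0 :> R by rewrite subr_eq0 eqr_nat.
have e : c0 + nu * l%:R - (c0 + nu * l'%:R) = nu * (l%:R - l'%:R) by ring.
have n0 : nu * (l%:R - l'%:R) != 0 by rewrite mulf_neq0// gt_eqF.
rewrite e /sinc_int (negbTE n0).
set sn := sin _; have sn1 : sn ^+ 2 <= 1.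
  by have := cos2Dsin2 (nu * (l%:R - l'%:R) * mu); rewrite -/sn;
    have := sqr_ge0 (cos (nu * (l%:R - l'%:R) * mu)); lra.
have DD := disc_inner_le j (aN1 l) (aN1 l').
apply: le_trans (ler_wpM2r (sqr_ge0 _) DD) _.
have p0 := @pi_gt0 R.
rewrite /N; set A := disc_norm _ _; set B := disc_norm _ _; set d := l%:R - _ in d0 *.
have AB : 0 <= A * B by rewrite mulr_ge0// ltW// disc_norm_gt0.
have -> : A * (alpha * (2 * mu)) * (B * (alpha * (2 * mu))) * (4 / (pi ^+ 2 * d ^+ 2)) =
    A * B * (alpha ^+ 2 * ((2 * mu) ^+ 2 * (4 / (pi ^+ 2 * d ^+ 2)))) by ring.
rewrite ler_wpM2l// exprMn ler_wpM2l ?sqr_ge0//.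
have gen (P m u : R) : P != 0 -> m != 0 -> d != 0 ->
    (2 * u / (P / (2 * m) * d)) ^+ 2 = (2 * m) ^+ 2 * (4 / (P ^+ 2 * d ^+ 2)) * u ^+ 2.
  by move=> P0 m0 _; field; rewrite P0 m0 d0.
rewrite gen// ?gt_eqF// ler_piMr// mulr_ge0 ?sqr_ge0// divr_ge0//.
by rewrite mulr_ge0 ?sqr_ge0.
Qed.

(* Only the indices [l'] with [l - l' = 2 P - 1 - 2 k], [k >= 0], occur, so that
   the odd integers larger than [2 P] are missing from [sum 4 / (pi n) ^ 2 = 1]. *)
Lemma bessel_strict (l P : nat) (j : int) (s : nat -> nat) :
  (forall k, l%:R - (s k)%:R = (2 * P%:R - 1) - 2 * k%:R :> R) ->
  (\esum_(j' in [set: int]) \esum_(k in [set: nat])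
     ((sqnormL2 W (H (s k) j'))^-1 *
      (cabs (innerL2 W (H l j) (H (s k) j')) ^+ 2)%:E) < sqnormL2 W (H l j))%E.
Proof.
move=> ls.
pose t j' k : R := (N (s k) j')^-1 * cabs (innerL2 W (H l j) (H (s k) j')) ^+ 2.
have tE j' k : ((sqnormL2 W (H (s k) j'))^-1 *
      (cabs (innerL2 W (H l j) (H (s k) j')) ^+ 2)%:E = (t j' k)%:E)%E.
  by rewrite sqnormH inver gt_eqF.
have t0 j' k : 0 <= t j' k by rewrite mulr_ge0 ?sqr_ge0// invr_ge0 ltW.
have q1 : 0 < 4 / (pi ^+ 2 * (2 * P + 1)%:R ^+ 2) :> R.
  by rewrite divr_gt0// mulr_gt0 ?exprn_gt0 ?pi_gt0// ltr0n addn1.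
rewrite sqnormH.
have -> : (\esum_(j' in [set: int]) \esum_(k in [set: nat])
     ((sqnormL2 W (H (s k) j'))^-1 *
      (cabs (innerL2 W (H l j) (H (s k) j')) ^+ 2)%:E) =
   \esum_(k in [set: nat]) (t j k)%:E)%E.
  (* By orthogonality only [j' = j] contributes, so the outer sum collapses to a singleton. *)
  rewrite -[RHS](@esum_set1 _ _ j (fun j' => \esum_(k in [set: nat]) (t j' k)%:E)%E); last first.
    by apply: esum_ge0 => k _; rewrite lee_fin.
  rewrite [RHS]esum_mkcond; apply: eq_esum => j' _.
  have [j'j|j'j] := eqVneq j j'.
    rewrite -j'j mem_set//; apply: eq_esum => k _; exact: tE.
  rewrite memNset; last by move=> /= e; rewrite e eqxx in j'j.
  by apply: esum1 => k _; rewrite tE /t innerH_neq// cabs0 expr0n mulr0.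
rewrite -nneseries_esumT; last by move=> k; rewrite lee_fin.
(* The gap does not depend on the number of terms, so strictness survives the passage to the
   limit. *)
apply: (@le_lt_trans _ _ (N l j * (1 - 4 / (pi ^+ 2 * (2 * P + 1)%:R ^+ 2)))%:E).
  apply: lime_le; first by apply: is_cvg_nneseries => k _ _; rewrite lee_fin.
  apply: nearW => n; rewrite sumEFin lee_fin.
  apply: le_trans (ler_wpM2l (ltW (N0 l j)) (sum_odd_sqr_shift P n)).
  rewrite mulr_sumr; apply: ler_sum => k _.
  have lk : l != s k.
    apply/eqP => lk; have := ls k; rewrite lk subrr => e.
    have /eqP : (2 * P)%:R = (2 * k + 1)%:R :> R by rewrite natrD !natrM; lra.
    by rewrite eqr_nat; lia.
  rewrite /t -ler_pdivlMl ?invr_gt0// invrK.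
  apply: le_trans (innerH_le j lk) _; rewrite ls.
  by rewrite le_eqVlt; apply/orP; left; apply/eqP; ring.
by rewrite lte_fin -[ltRHS]mulr1 ltr_pM2l// ltrBlDr ltrDl.
Qed.

(* The witness is [H (1 - e) 0] times [exp (- i (3 - 2 e) nu log |z_2|^2)]. *)
Lemma not_complete (e : nat) (S : set (C2 R -> R[i]^o)) : (e <= 1)%N ->
  (forall g, S g -> exists (k : nat) (j : int), g = H (2 * k + e)%N j) ->
  ~ bergman_complete W S.
Proof.
move=> e1 HS.
have er : e%:R <= 1 :> R by rewrite lern1.
pose a := c0 + nu * (1 - e)%N%:R.
have a1 : -1 < a by exact: aN1.
have numu : nu * mu = pi / 2 by rewrite invfM mulrA mulfVK// gt_eqF.
have lE : (1 - e)%N%:R = 1 - e%:R :> R by rewrite natrB.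
(* The second frequency is the one that the index [e - 2] would have: of the parity of the system,
   but negative and hence absent from it. It differs from the frequencies of the system by
   [2 (k + 1) nu], where the annulus integral vanishes, and from that of [H (1 - e)] by
   [(3 - 2 e) nu], where it does not. *)
apply: (@not_bergman_complete _ W S (H (1 - e)%N 0) (wormT a (c0 - nu * (2 - e%:R)) 0)).
- exact: measurable_worm4.
- exact: bergman_wormH.
- exact: L2_wormH.
- exact: L2_wormT.
- rewrite wormHE innerT_eq// -/a disc_inner_diag -rmorphM /= -cabs_gt0 cabs_real normr_gt0.
  apply: mulf_neq0; first by rewrite gt_eqF// disc_norm_gt0.
  apply: mulf_neq0; first by rewrite gt_eqF// disc_area_gt0.
  have -> : a - (c0 - nu * (2 - e%:R)) = nu * (3 - 2 * e%:R) by rewrite /a lE; ring.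
  have h0 : 0 < nu * (3 - 2 * e%:R) by rewrite mulr_gt0//; lra.
  rewrite /sinc_int (gt_eqF h0); apply: mulf_neq0; last by rewrite invr_eq0 gt_eqF.
  apply: mulf_neq0 => //; rewrite mulrAC numu.
  (* The two values are [sin (3 pi / 2) = -1] for [e = 0] and [sin (pi / 2) = 1] for [e = 1]. *)
  case: e e1 {HS er a a1 lE h0} => [|[|//]] _.
    have -> : pi / 2 * (3 - 2 * 0%:R) = pi / 2 + pi :> R by field.
    by rewrite sinDpi sin_pihalf oppr_eq0 oner_neq0.
  by rewrite mulr1 (_ : 3 - 2 = 1) ?mulr1 ?sin_pihalf ?oner_neq0//; ring.
- move=> g /HS [k [j ->]]; split; first exact: L2_wormH.
  rewrite wormHE; have [->|j0] := eqVneq j 0; last by rewrite innerT_neq.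
  rewrite innerT_eq//.
  have -> : c0 + nu * (2 * k + e)%:R - (c0 - nu * (2 - e%:R)) = nu * (k.+1%:R * 2).
    by rewrite natrD natrM -natr1; ring.
  have h0 : 0 < nu * (k.+1%:R * 2) by rewrite mulr_gt0// mulr_gt0.
  rewrite /sinc_int (gt_eqF h0).
  have -> : nu * (k.+1%:R * 2) * mu = pi *+ k.+1.
    by rewrite mulrAC numu mulrCA mulfVK// mulr_natl.
  have -> : sin (pi *+ k.+1) = 0 :> R.
    elim: k.+1 => [|n IH]; first by rewrite mulr0n sin0.
    by rewrite mulrSr sinDpi IH oppr0.
  by rewrite mulr0 mul0r mulr0 mulr0.
Qed.

End Worm.

Theorem proposition3p2 (R : realType) (mu c0 : R)
    (hmu : pi / 2 < mu) (hc0 : -1 < c0) :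
  let W := worm mu in
  let H := wormH c0 (pi / (2 * mu)) in
  [/\ forall (l : nat) (j : int), bergman W (H l j),
      forall (m : nat) (j : int),
        (\esum_(j' in [set: int]) \esum_(k in [set: nat])
           ((sqnormL2 W (H (2 * k)%N j'))^-1 *
            (cabs (innerL2 W (H (2 * m + 1)%N j) (H (2 * k)%N j')) ^+ 2)%:E)
         < sqnormL2 W (H (2 * m + 1)%N j))%E,
      forall (k : nat) (j : int),
        (\esum_(j' in [set: int]) \esum_(m in [set: nat])
           ((sqnormL2 W (H (2 * m + 1)%N j'))^-1 *
            (cabs (innerL2 W (H (2 * k)%N j) (H (2 * m + 1)%N j')) ^+ 2)%:E)
         < sqnormL2 W (H (2 * k)%N j))%E,
      ~ bergman_complete W
          [set f | exists (k : nat) (j : int), f = H (2 * k)%N j] &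
      ~ bergman_complete W
          [set f | exists (m : nat) (j : int), f = H (2 * m + 1)%N j]].
Proof.
move=> W H; split.
- exact: bergman_wormH.
(* [P] counts the positive odd differences: [2 m + 1 - 2 k] takes the [m + 1] values
   [1, 3, ..., 2 m + 1], while in the other case [2 k - (2 m + 1)] takes the [k] values
   [1, 3, ..., 2 k - 1]. *)
- move=> m j; apply: (@bessel_strict _ mu c0 hmu hc0 _ m.+1 j (fun k => (2 * k)%N)) => k.
  by rewrite natrD !natrM -natr1; ring.
- move=> k j; apply: (@bessel_strict _ mu c0 hmu hc0 _ k j (fun m => (2 * m + 1)%N)) => m.
  by rewrite natrD !natrM; ring.
- apply: (@not_complete _ mu c0 hmu hc0 0%N) => // g [k [j ->]].
  by exists k, j; rewrite addn0.
- by apply: (@not_complete _ mu c0 hmu hc0 1%N).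
Qed.
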